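(* Suppose that, for $i=1,\dots,d$, $e^i$ is an optional process with $\varepsilon\le e^i\le1/\varepsilon$ for some $\varepsilon>0$, $U^i$ is a regular utility function, and $\Gamma^i$ is a withdrawal-cap process for $e^i$. Then there exists an abstract equilibrium $(\mathbb Q,(c^i)_{i=1,\dots,d})$.
   Context: Fix $T>0$, $d\in\mathbb N$ and a filtered probability space $(\Omega,\mathcal F,(\mathcal F_t)_{t\in[0,T]},\mathbb P)$ with $(\mathcal F_t)$ right-continuous and complete, $\mathcal F_0$ trivial modulo $\mathbb P$, $\mathcal F=\mathcal F_T$. $\kappa$ is the measure on $[0,T]$ with $d\kappa_t=dt$ on $[0,T)$ and $\kappa(\{T\})=1$. Total convexity norm of a continuously differentiable $f:[x_1,x_2]\to\mathbb R$: $\|f\|_{[x_1,x_2]}=|f(x_1)|+|f'(x_1)|+\mathrm{TV}(f';[x_1,x_2])$, with TV the total variation. A function $f:[0,T]\times[x_1,x_2]\to\mathbb R$, continuously differentiable in the second variable, is convexity-Lipschitz if $\|f(t,\cdot)\|_{[x_1,x_2]}<\infty$ for all $t$ and there is $C$ with $\|f(t,\cdot)-f(s,\cdot)\|_{[x_1,x_2]}\le C|t-s|$ for all $t,s\in[0,T]$. A function on $[0,T]\times I$ is locally convexity-Lipschitz if its restriction to $[0,T]\times[x_1,x_2]$ is convexity-Lipschitz for every compact interval $[x_1,x_2]\subseteq I$. Regular utility function: $U^i:[0,T]\times(0,\infty)\to\mathbb R$ such that (a) $U^i(t,\cdot)$ is strictly concave, continuously differentiable and strictly increasing for each $t$, and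 $U^i(\cdot,x)$ is bounded for each $x>0$; (b) $I^i:[0,T]\times(0,\infty)\to(0,\infty)$, $I^i(t,\cdot)=(U^i_x(t,\cdot))^{-1}$, is locally convexity-Lipschitz and $\lim_{y\to\infty}I^i(t,y)=0$, $\lim_{y\to0}I^i(t,y)=\infty$, uniformly in $t\in[0,T]$. Convention: $U^i(t,0)=\lim_{x\downarrow0}U^i(t,x)$. Utility functional: for an optional $c\ge0$, $\mathbb U^i(c)=\mathbb E\int_0^TU^i(t,c(t))\,d\kappa_t$ if $\mathbb E\int_0^T\min(0,U^i(t,c(t)))\,d\kappa_t>-\infty$, and $\mathbb U^i(c)=-\infty$ otherwise. Withdrawal-cap process for $e^i$: a $(0,\infty]$-valued càdlàg adapted process $\Gamma^i$ with $\Gamma^i>e^i$ and $\Gamma^i_T=\infty$ a.s. $\mathcal O$ is the $\sigma$-algebra of $(\mathcal F_t)$-optional subsets of $[0,T]\times\Omega$; $\mathbb L^\infty$ is the Banach space of $(\kappa\otimes\mathbb P)$-essentially bounded $\mathcal O$-measurable processes, $\mathbb L^\infty_+$ its nonnegative elements; (in)equalities are $(\kappa\otimes\mathbb P)$-a.e. The dual $(\mathbb L^\infty)^*$ is identified with the finitely-additive measures on $\mathcal O$ vanishing on $(\kappa\otimes\mathbb P)$-null sets; a finitely-additive probability is a nonnegative element of total mass one, and $\langle\mathbb Q,c\rangle$ is the dual pairing. $\mathcal A^i=\{c\in\mathbb L^\infty_+: c\le\Gamma^i\}$, $\mathcal A=\{(c^i)_{i=1,\dots,d}: c^i\in\mathcal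 A^i\}$. Budget set: $B^i(\mathbb Q)=\{c\in\mathcal A^i:\langle\mathbb Q,c\rangle\le\langle\mathbb Q,e^i\rangle\}$. Abstract equilibrium: a pair $(\mathbb Q,(c^i)_{i=1,\dots,d})$ of a finitely-additive probability $\mathbb Q\in(\mathbb L^\infty)^*$ and an allocation $(c^i)\in\mathcal A$ such that (1) $\sum_ic^i=\sum_ie^i$; (2) for each $i$, $c^i\in B^i(\mathbb Q)$ and $\mathbb U^i(c^i)\ge\mathbb U^i(c)$ for all $c\in B^i(\mathbb Q)$. *)

(* Defs.v *)
From HB Require Import structures.
From mathcomp Require Import all_boot all_order all_algebra.
From mathcomp Require Import all_classical all_reals all_analysis.
From mathcomp Require Import measurable_realfun.

Set Implicit Arguments.
Unset Strict Implicit.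
Unset Printing Implicit Defensive.

Import Order.TTheory GRing.Theory Num.Theory.
Import numFieldNormedType.Exports.

Local Open Scope classical_set_scope.
Local Open Scope ring_scope.

(* Processes are functions on the whole of [R * Omega] (time, scenario), but
   only their restriction to [horizon T] is ever used: [kappa T] does not charge
   the complement of [0, T]. *)
Definition horizon (R : realType) (T : R) (Omega : Type) : set (R * Omega) :=
  [set` `[0, T]] `*` setT.
Arguments horizon {R} T {Omega}.

Definition kappa (R : realType) (T : R) :
    set (measurableTypeR R) -> \bar R :=
  measure_add (mrestr lebesgue_measure (measurable_itv `[0, T[))
    (dirac (T : measurableTypeR R)).

HB.instance Definition _ (R : realType) (T : R) :=
  Measure.on (@kappa R T).

Definition ae_process (R : realType) (T : R) (disp : measure_display)
    (Omega : measurableType disp) (P : probability Omega R)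
    (Pr : R * Omega -> Prop) : Prop :=
  {ae (kappa T \x P)%E, forall z, horizon T z -> Pr z}.

Record standing_filtration (R : realType) (T : R) (disp : measure_display)
    (Omega : measurableType disp) (P : probability Omega R)
    (F : R -> set (set Omega)) : Prop := StandingFiltration {
  filtration_sigma : forall t : R, t \in `[0, T] -> sigma_algebra setT (F t);
  filtration_mono : forall s t : R, s \in `[0, T] -> t \in `[0, T] ->
    s <= t -> F s `<=` F t;
  filtration_right_continuous : forall t : R, t \in `[0, T[ ->
    F t = \bigcap_(s in [set` `]t, T]]) F s;
  filtration_complete : P.-negligible `<=` F 0;
  filtration_trivial0 : forall A, F 0 A -> P A = 0%E \/ P A = 1%E;
  filtration_terminal : F T = measurable
}.

(* [E] is [R] or, for withdrawal caps, [\bar R]. *)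
Definition adapted (R : realType) (T : R) (Omega : Type)
    (F : R -> set (set Omega)) (disp' : measure_display)
    (E : measurableType disp') (X : R * Omega -> E) : Prop :=
  forall t : R, t \in `[0, T] -> forall B, measurable B ->
    F t [set w | B (X (t, w))].

Definition cadlag (R : realType) (T : R) (Omega : Type)
    (E : topologicalType) (X : R * Omega -> E) : Prop :=
  forall w,
    (forall t : R, t \in `[0, T[ -> X (s, w) @[s --> t^'+] --> X (t, w)) /\
    (forall t : R, t \in `]0, T] ->
      exists l : E, X (s, w) @[s --> t^'-] --> l).

Definition optional_sets (R : realType) (T : R) (Omega : Type)
    (F : R -> set (set Omega)) : set (set (R * Omega)) :=
  <<s horizon T,
      \bigcup_(X in [set X : R * Omega -> R | adapted T F X /\ cadlag T X])
        preimage_set_system (horizon T) X measurable >>.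

Definition optional (R : realType) (T : R) (Omega : Type)
    (F : R -> set (set Omega)) (c : R * Omega -> R) : Prop :=
  preimage_set_system (horizon T) c measurable `<=` optional_sets T F.

(* Elements of L^oo are represented by functions, (kappa \x P)-a.e. equal
   functions being identified. *)
Definition Linfty (R : realType) (T : R) (disp : measure_display)
    (Omega : measurableType disp) (P : probability Omega R)
    (F : R -> set (set Omega)) : set (R * Omega -> R) :=
  [set c | optional T F c /\ ('N[(kappa T \x P)%E]_+oo [EFin \o c] < +oo)%E].

Definition Linfty_ge0 (R : realType) (T : R) (disp : measure_display)
    (Omega : measurableType disp) (P : probability Omega R)
    (F : R -> set (set Omega)) : set (R * Omega -> R) :=
  [set c | Linfty T P F c /\ ae_process T P (fun z => 0 <= c z)].

(* A finitely-additive probability is given by its dual pairing [c |-> <Q, c>]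
   with L^oo; [finadd_bounded] makes it constant on a.e.-equality classes. *)
Record finadd_probability (R : realType) (T : R) (disp : measure_display)
    (Omega : measurableType disp) (P : probability Omega R)
    (F : R -> set (set Omega)) (Q : (R * Omega -> R) -> R) : Prop :=
  FinaddProbability {
  finadd_linear : forall (a : R) (c c' : R * Omega -> R),
    Linfty T P F c -> Linfty T P F c' ->
    Q (fun z => a * c z + c' z) = a * Q c + Q c';
  finadd_bounded : exists K : R, forall c, Linfty T P F c ->
    (`|Q c|%:E <= K%:E * 'N[(kappa T \x P)%E]_+oo [EFin \o c])%E;
  finadd_ge0 : forall c, Linfty_ge0 T P F c -> 0 <= Q c;
  finadd_mass1 : Q (cst 1) = 1
}.

(* Two-sided derivatives: only used for [x1], [x2] interior to the domain of
   [f], where they agree with the one-sided derivatives of the restriction. *)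
Definition total_convexity_norm (R : realType) (x1 x2 : R) (f : R -> R) :
    \bar R :=
  (`|f x1|%:E + `|derive1 f x1|%:E + total_variation x1 x2 (derive1 f))%E.

Definition C1_on (R : realType) (D : set R) (f : R -> R) : Prop :=
  (forall x : R, D x -> derivable f x 1) /\ {within D, continuous derive1 f}.

Definition convexity_Lipschitz (R : realType) (T x1 x2 : R)
    (f : R -> R -> R) : Prop :=
  [/\ forall t : R, t \in `[0, T] -> C1_on [set` `[x1, x2]] (f t),
      forall t : R, t \in `[0, T] -> (total_convexity_norm x1 x2 (f t) < +oo)%E &
      exists C : R, forall t s : R, t \in `[0, T] -> s \in `[0, T] ->
        (total_convexity_norm x1 x2 (f t \- f s)%R <= (C * `|t - s|)%:E)%E].

(* [D] is an open interval. *)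
Definition locally_convexity_Lipschitz (R : realType) (T : R) (D : set R)
    (f : R -> R -> R) : Prop :=
  forall x1 x2 : R, x1 < x2 -> [set` `[x1, x2]] `<=` D ->
    convexity_Lipschitz T x1 x2 f.

Definition strictly_concave_on (R : realType) (D : set R) (u : R -> R) : Prop :=
  forall x y l : R, D x -> D y -> x != y -> 0 < l -> l < 1 ->
    l * u x + (1 - l) * u y < u (l * x + (1 - l) * y).

(* [I t] is the inverse of the marginal utility, as a map from ]0, +oo[ onto
   ]0, +oo[. *)
Definition inverse_marginal (R : realType) (T : R) (U I : R -> R -> R) : Prop :=
  forall t : R, t \in `[0, T] ->
    [/\ forall x : R, 0 < x -> 0 < derive1 (U t) x,
        forall y : R, 0 < y -> 0 < I t y,
        forall x : R, 0 < x -> I t (derive1 (U t) x) = x &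
        forall y : R, 0 < y -> derive1 (U t) (I t y) = y].

(* Borel measurability in [t] is what the integral of [U t (c t)] against
   [kappa] in the utility functional presupposes; continuity in [x] then makes
   [U] jointly measurable. *)
Record regular_utility (R : realType) (T : R) (U : R -> R -> R) : Prop :=
  RegularUtility {
  utility_strictly_concave : forall t : R, t \in `[0, T] ->
    strictly_concave_on [set` `]0, +oo[] (U t);
  utility_C1 : forall t : R, t \in `[0, T] -> C1_on [set` `]0, +oo[] (U t);
  utility_increasing : forall t : R, t \in `[0, T] ->
    forall x y : R, 0 < x -> x < y -> U t x < U t y;
  utility_bounded : forall x : R, 0 < x ->
    exists M : R, forall t : R, t \in `[0, T] -> `|U t x| <= M;
  utility_measurable : forall x : R, 0 < x ->
    measurable_fun [set` `[0, T]] (fun t => U t x);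
  utility_inverse_marginal : exists I : R -> R -> R,
    [/\ inverse_marginal T U I,
        locally_convexity_Lipschitz T [set` `]0, +oo[] I,
        (forall eps : R, 0 < eps ->
          \forall y \near +oo, forall t : R, t \in `[0, T] -> `|I t y| < eps) &
        (forall M : R,
          \forall y \near 0^'+, forall t : R, t \in `[0, T] -> M < I t y)]
}.

(* The value at 0 may be -oo; only arguments [x >= 0] matter. *)
Definition utility_ext (R : realType) (u : R -> R) (x : R) : \bar R :=
  if 0 < x then (u x)%:E else lim ((u z)%:E @[z --> 0^'+]).

Definition utility_functional (R : realType) (T : R) (disp : measure_display)
    (Omega : measurableType disp) (P : probability Omega R) (U : R -> R -> R)
    (c : R * Omega -> R) : \bar R :=
  (if -oo < \int[P]_w \int[kappa T]_(t in [set` `[0%R, T]])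
              mine 0 (utility_ext (U t) (c (t, w)))
   then \int[P]_w \int[kappa T]_(t in [set` `[0%R, T]])
          utility_ext (U t) (c (t, w))
   else -oo)%E.

Record withdrawal_cap (R : realType) (T : R) (disp : measure_display)
    (Omega : measurableType disp) (P : probability Omega R)
    (F : R -> set (set Omega)) (e : R * Omega -> R)
    (Gamma : R * Omega -> \bar R) : Prop := WithdrawalCap {
  cap_gt0 : forall z, horizon T z -> (0 < Gamma z)%E;
  cap_adapted : adapted T F Gamma;
  cap_cadlag : cadlag T Gamma;
  cap_gt : ae_process T P (fun z => ((e z)%:E < Gamma z)%E);
  cap_terminal : {ae P, forall w, Gamma (T, w) = +oo%E}
}.

Definition admissible (R : realType) (T : R) (disp : measure_display)
    (Omega : measurableType disp) (P : probability Omega R)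
    (F : R -> set (set Omega)) (Gamma : R * Omega -> \bar R) :
    set (R * Omega -> R) :=
  [set c | Linfty_ge0 T P F c /\
           ae_process T P (fun z => ((c z)%:E <= Gamma z)%E)].

Definition budget_set (R : realType) (T : R) (disp : measure_display)
    (Omega : measurableType disp) (P : probability Omega R)
    (F : R -> set (set Omega)) (e : R * Omega -> R)
    (Gamma : R * Omega -> \bar R) (Q : (R * Omega -> R) -> R) :
    set (R * Omega -> R) :=
  [set c | admissible T P F Gamma c /\ Q c <= Q e].

Record abstract_equilibrium (R : realType) (T : R) (disp : measure_display)
    (Omega : measurableType disp) (P : probability Omega R)
    (F : R -> set (set Omega)) (d : nat) (U : 'I_d -> R -> R -> R)
    (e : 'I_d -> R * Omega -> R) (Gamma : 'I_d -> R * Omega -> \bar R)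
    (Q : (R * Omega -> R) -> R) (c : 'I_d -> R * Omega -> R) : Prop :=
  AbstractEquilibrium {
  equilibrium_price : finadd_probability T P F Q;
  equilibrium_allocation : forall i, admissible T P F (Gamma i) (c i);
  equilibrium_clearing : ae_process T P
    (fun z => \sum_(i < d) c i z = \sum_(i < d) e i z);
  equilibrium_optimal : forall i,
    budget_set T P F (e i) (Gamma i) Q (c i) /\
    forall c', budget_set T P F (e i) (Gamma i) Q c' ->
      (utility_functional T P (U i) c' <= utility_functional T P (U i) (c i))%E
}.

(* Main.v *)
(** Negishi's method. For utility weights [l] in the simplex, maximize weighted
    utility state by state: agent [i] consumes the smaller of the cap and
    [I i t (y / l i)], where the state price [y] clears the market. Every endowment is at
    least [eps i] and [I i] vanishes at infinity uniformly in time, so [y] is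
    bounded; it is a continuous function of [l], even where weights vanish. The
    gaps between values of endowment and consumption thus depend continuously
    on [l], they sum to zero, and they are nonnegative for agents of weight zero.
    A combinatorial lemma of Scarf, in the place of Sperner's, yields weights at
    which all gaps vanish. These weights are positive, because nobody is capped
    at the terminal time, so that [y] cannot vanish there. Concavity of the
    utilities shows that consumption is optimal for the finitely additive
    (indeed countably additive) probability with density proportional to [y]. *)
Require Import Defs.
From HB Require Import structures.
From mathcomp Require Import all_boot.

Set Implicit Arguments.
Unset Strict Implicit.
Unset Printing Implicit Defensive.

(** * Scarf's lemma *)

(** The unknown is a point of a simplex, not a price in the dual of [L^oo], so no
    infinite-dimensional fixed point is needed. Caps are the obstacle. The agents of positive weight
    may be unable to absorb the supply; the price is then 0 and the market does not clear. If they
    only just absorb it, an interval of prices clears. Taking the largest clearing price settles the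
    choice and makes the price continuous in the weights. Consumption may still jump where the price
    reaches zero, but expenditure, price times consumption, does not, and the gaps involve nothing
    else. Positivity comes in two stages. The atom of [kappa] at [T] keeps the price from vanishing
    a.e. for any weights; this makes the weights positive at a zero of the gaps. With all weights
    positive, [e i < Gamma i] makes the caps together exceed the supply, so that the price is
    positive, and the market clears, in almost every state. Everything must also be optional: prices
    and demands are compared with rational levels only, and [I i] at a fixed level is optional
    because it is Lipschitz in time. *)

Section DominatingSets.
Context {W I : finType}.
Variable r : I -> W -> nat.
Hypothesis r_inj : forall i, injective (r i).

(** Scarf's primitive sets: the orders leave no room strictly above all the minima of [Y]. *)
Definition dominating (Y : {set W}) : bool :=
  [forall v, exists i, [forall x in Y, r i v <= r i x]].

Lemma dominatingP (Y : {set W}) :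
  reflect (forall v, exists i, {in Y, forall x, r i v <= r i x})
          (dominating Y).
Proof.
apply: (iffP forallP) => h v.
  by have /existsP[i /forall_inP hi] := h v; exists i.
by have [i hi] := h v; apply/existsP; exists i; apply/forall_inP.
Qed.

Lemma dominating_sub (Y X : {set W}) : Y \subset X -> dominating X -> dominating Y.
Proof.
move=> /subsetP sYX /dominatingP h; apply/dominatingP => v.
by have [i hi] := h v; exists i => x /sYX /hi.
Qed.

Lemma subset_succ_card (Y X : {set W}) : Y \subset X -> #|X| = #|Y|.+1 ->
  exists2 x, x \notin Y & X = x |: Y.
Proof.
move=> sYX cX; have : #|X :\: Y| == 1%N.
  by rewrite cardsD (setIidPr sYX) cX subSnn.
move=> /cards1P[x hx]; exists x.
  by have := set11 x; rewrite -hx inE => /andP[].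
by rewrite -hx setUC -{1}(setID X Y) (setIidPr sYX).
Qed.

(* Exactly two indices have the same minimizer over [Y]; giving up either of them
   leads, if possible, to a unique larger dominating set. *)
Section Door.
Variable Y : {set W}.
Hypotheses (domY : dominating Y) (cardY : #|I| = #|Y|.+1).
Variable y0 : W.
Hypothesis y0Y : y0 \in Y.

Let m i := [arg min_(x < y0 in Y) r i x].

Let mY i : m i \in Y.
Proof. by rewrite /m; case: arg_minnP. Qed.

Let mP i x : x \in Y -> r i (m i) <= r i x.
Proof. by rewrite /m; case: arg_minnP => // y yY h /h. Qed.

Let m_eq i y : y \in Y -> {in Y, forall x, r i y <= r i x} -> m i = y.
Proof.
move=> yY h; apply: (r_inj (i := i)); apply/eqP.
by rewrite eqn_leq mP //= h.
Qed.

Let m_surj y : y \in Y -> exists i, m i = y.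
Proof.
by move=> yY; have /dominatingP/(_ y)[i hi] := domY; exists i; apply: m_eq.
Qed.

Let collision : exists i j, i != j /\ m i = m j.
Proof.
have : ~~ injectiveb m.
  apply/negP => /injectiveP/card_codom cm.
  have : #|codom m| <= #|Y|.
    by apply: subset_leq_card; apply/subsetP => _ /codomP[i ->]; apply: mY.
  by rewrite cm cardY ltnn.
by move=> /injectivePn[i [j ij mij]]; exists i, j.
Qed.

(** If order [k] is to get its minimum from an element added to [Y], the new element must be sought
    here, and it must be the highest one here in order [k]. *)
Let B k := [set v | [forall l, (l != k) ==> (r l (m l) < r l v)]].

Let BP k v : reflect (forall l, l != k -> r l (m l) < r l v) (v \in B k).
Proof.
rewrite inE; apply: (iffP forallP) => h l; first by move: (h l) => /implyP.
by apply/implyP/h.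
Qed.

Let room x := (x \notin Y) && dominating (x |: Y).

Section Removable.
Variables k k' : I.
Hypotheses (kk' : k' != k) (mkk' : m k = m k').

Let m_surjD1 y : y \in Y -> exists2 l, l != k & m l = y.
Proof.
move=> /m_surj[l ml]; have [lk|lk] := eqVneq l k; last by exists l.
by exists k' => //; rewrite -mkk' -lk.
Qed.

(** As [k] shares its minimizer with [k'], the orders other than [k] still reach all of [Y]. There
    are exactly as many of them as elements of [Y], so this surjection is injective. *)
Lemma m_injD1 l l' : l != k -> l' != k -> m l = m l' -> l = l'.
Proof.
have : {in [set~ k] &, injective m}.
  apply/imset_injP; rewrite cardsC1 cardY /=; apply/eqP/eq_card => y.
  apply/imsetP/idP => [[h _ ->]|/m_surjD1[h hk <-]]; first exact: mY.
  by exists h; rewrite // !inE.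
by move=> h lk l'k; apply: h; rewrite !inE.
Qed.

(** The old minimum [m l] must be dominated in the larger set. Order [k] cannot do it, since [x] is
    lower there, so by injectivity only order [l] can, which puts [x] above [m l]. An element of
    [B k], in turn, can be dominated in order [k] only. *)
Lemma room_max x : x \notin Y -> dominating (x |: Y) ->
  {in Y, forall u, r k x <= r k u} ->
  x \in B k /\ {in B k, forall v, r k v <= r k x}.
Proof.
move=> xY /dominatingP dX xk.
have xB : x \in B k.
  apply/BP => l lk.
  have [l' hl'] := dX (m l).
  have l'k : l' != k.
    apply/eqP => ?; subst l'.
    have := hl' x; rewrite !inE eqxx /= => /(_ erefl) h.
    have e : r k (m l) = r k x by apply/eqP; rewrite eqn_leq h xk.
    by move: xY; rewrite -(r_inj e) mY.
  have ml' : m l' = m l.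
    by apply: m_eq => // u uY; apply: hl'; rewrite !inE uY orbT.
  have ? := m_injD1 l'k lk ml'; subst l'.
  have := hl' x; rewrite !inE eqxx /= => /(_ erefl).
  rewrite leq_eqVlt => /orP[/eqP/r_inj e|//].
  by move: xY; rewrite -e mY.
split => // v /BP vB; have [l hl] := dX v.
have [lk|lk] := eqVneq l k; first by rewrite -lk; apply: hl; rewrite !inE eqxx.
have := vB _ lk; rewrite ltnNge hl //.
by rewrite !inE mY orbT.
Qed.

(** Converse of [room_max]: elements of [B k] are dominated in order [k] by maximality of [x], all
    others in an order [l] whose minimum [x] leaves unchanged. *)
Lemma max_room x : x \in B k -> {in B k, forall v, r k v <= r k x} -> room x.
Proof.
move=> /BP xB xmax; apply/andP; split.
  apply/negP => /m_surjD1[l lk ml].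
  by have := xB _ lk; rewrite ml ltnn.
apply/dominatingP => v; have [/BP vB|vB] := boolP (v \in B k).
  exists k => u; rewrite !inE => /orP[/eqP->|uY]; first by apply: xmax; apply/BP.
  have /dominatingP/(_ v)[l hl] := domY.
  have [lk|lk] := eqVneq l k; first by rewrite -lk hl.
  by have := vB _ lk; rewrite ltnNge hl.
move: vB; rewrite inE negb_forall => /existsP[l]; rewrite negb_imply -leqNgt.
move=> /andP[lk hl]; exists l => u; rewrite !inE => /orP[/eqP->|uY].
  exact/(leq_trans hl)/ltnW/xB.
exact/(leq_trans hl)/mP.
Qed.

End Removable.

(** The two rooms arise by freeing [i] or [j], the orders with a common minimizer. The added
    elements differ, because a common one would lie above the minimum of [Y] in every order, and [Y]
    is dominating. *)
Lemma door_two_rooms :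
  (forall k, exists w, forall l, l != k -> exists2 y, y \in Y & r l y < r l w) ->
  #|[set X : {set W} | [&& Y \subset X, #|X| == #|I| & dominating X]]| = 2.
Proof.
move=> Bn0; have [i [j [ij mij]]] := collision.
have ji : j != i by rewrite eq_sym.
have mji : m j = m i by [].
have ex k : exists x, x \in B k /\ {in B k, forall v, r k v <= r k x}.
  have [w hw] := Bn0 k.
  have wB : w \in B k.
    by apply/BP => l /hw[y yY]; apply/leq_ltn_trans/mP.
  by case: (arg_maxnP (r k) wB) => x xB hx; exists x.
have [xi [xiB xiM]] := ex i.
have [xj [xjB xjM]] := ex j.
have /andP[xiY domi] := max_room ji mij xiB xiM.
have /andP[xjY domj] := max_room ij mji xjB xjM.
have xij : xi != xj.
  apply/eqP => e; have /dominatingP/(_ xi)[l hl] := domY.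
  have [li|li] := eqVneq l i.
    move: xjB => /BP/(_ l); rewrite li => /(_ ij).
    by rewrite -e ltnNge -li hl.
  by move: xiB => /BP/(_ l li); rewrite ltnNge hl.
rewrite (_ : [set _ | _] = [set xi |: Y; xj |: Y]).
  rewrite cards2; suff -> : xi |: Y != xj |: Y by [].
  apply/eqP => /setP/(_ xi); rewrite !inE eqxx (negbTE xiY) (negbTE xij).
  by [].
apply/setP => X; rewrite !inE; apply/idP/orP; last first.
  by case=> /eqP->; rewrite subsetUr cardsU1 ?(xiY, xjY) cardY eqxx.
move=> /and3P[sYX /eqP cX dX].
have [x xY eX] : exists2 x, x \notin Y & X = x |: Y.
  by apply: subset_succ_card => //; rewrite cX.
subst X; have /dominatingP/(_ x)[k hk] := dX.
have {}hk : {in Y, forall u, r k x <= r k u}.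
  by move=> u uY; apply: hk; rewrite !inE uY orbT.
have hu k1 x1 : x \in B k1 -> {in B k1, forall v, r k1 v <= r k1 x} ->
    x1 \in B k1 -> {in B k1, forall v, r k1 v <= r k1 x1} -> x = x1.
  move=> xB xM x1B x1M; apply: (r_inj (i := k1)); apply/eqP.
  by rewrite eqn_leq x1M // xM.
have [?|ki] := eqVneq k i.
  by subst k; have [xB xM] := room_max ji mij xY dX hk; left; rewrite (hu i xi).
have [?|kj] := eqVneq k j.
  by subst k; have [xB xM] := room_max ij mji xY dX hk; right; rewrite (hu j xj).
(* For [k] other than [i] and [j], the element [m k] is the minimizer of order [k] alone. Since [x]
   is now lower in that order, no order is left to dominate [m k]. *)
have /dominatingP/(_ (m k))[l hl] := dX.
have ml : m l = m k.
  by apply: m_eq => // u uY; apply: hl; rewrite !inE uY orbT.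
exfalso.
have lk : l != k.
  apply/eqP => ?; subst l.
  have := hl x; rewrite !inE eqxx /= => /(_ erefl) h.
  have e : r k (m k) = r k x by apply/eqP; rewrite eqn_leq h hk.
  by move: xY; rewrite -(r_inj e) mY.
have [li|li] := eqVneq l i.
  have : l = k by apply: (m_injD1 ij mji) => //; rewrite li.
  by move/eqP; rewrite (negbTE lk).
have : l = k by apply: (m_injD1 ji mij).
by move/eqP; rewrite (negbTE lk).
Qed.

End Door.
End DominatingSets.

(* Rooms are dominating sets with as many elements as [I]; doors are dominating
   sets in which the colors other than [i0] occur once each. The number of fully
   colored rooms is odd: a room contains one door if it is fully colored and
   zero or two otherwise, and a door lies in two rooms, except [Y0], which lies
   in one. *)
Section Scarf.
Context {V I : finType}.
Variable r : I -> V -> nat.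
Hypothesis r_inj : forall i, injective (r i).
Variable c : V -> I.
Variables (i0 : I) (v0 : V).

(* Slack vertices [inr j] are lowest for the order of index [j] and above [V] for
   the other orders; a pair (s, C) with s in V and C in I becomes the
   set [inl @: s :|: inr @: ~: C]. *)
Let W := (V + I)%type.
Let top := \max_i \max_v r i v.
Let R (i : I) (x : W) : nat :=
  match x with
  | inl v => (r i v).+1
  | inr j => if j == i then 0 else top.+2 + enum_rank j
  end.
Let col (x : W) : I := match x with inl v => c v | inr j => j end.

Let r_top i v : r i v <= top.
Proof.
apply: leq_trans (leq_bigmax (F := fun i => \max_v r i v) i).
exact: (leq_bigmax (F := r i)).
Qed.

Let R_inj i : injective (R i).
Proof.
have lt v j : (r i v).+1 <> top.+2 + j.
  by move=> h; have := r_top i v; rewrite -ltnS h addSn ltnNge leq_addr.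
move=> [u|j] [v|k] /=.
- by move=> [/r_inj ->].
- by case: eqP => // _ /lt.
- by case: eqP => // _ /esym /lt.
- case: eqP => [->|_]; case: eqP => [->|_] //.
  by move=> /addnI /ord_inj /enum_rank_inj ->.
Qed.

Let dom := dominating R.
Let rooms := [set X : {set W} | (#|X| == #|I|) && dom X].
Let doors := [set Y : {set W} |
  [&& #|Y|.+1 == #|I|, dom Y & col @: Y == ~: [set i0]]].

(** A door arises from a fully colored room only by removing the element of color [i0]. In any other
    room that has a door, exactly two elements share a color, and the doors are obtained by removing
    one or the other. *)
Lemma room_doors X : X \in rooms ->
  odd #|[set Y in doors | Y \subset X]| = (col @: X == setT).
Proof.
rewrite inE => /andP[/eqP cX domX].
have [/eqP cT|cNT] := boolP (col @: X == setT).
  have cinj : {in X &, injective col}.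
    by apply/imset_injP; rewrite cT cardsT cX.
  have /imsetP[x xX cx] : i0 \in col @: X by rewrite cT.
  rewrite (_ : [set _ in _ | _] = [set X :\ x]) ?cards1//.
  apply/setP => Y; rewrite !inE; apply/andP/eqP => [[/and3P[/eqP cY dY /eqP colY] sYX]|->].
    apply/eqP; rewrite eqEcard subsetD1 sYX/=.
    have -> : x \notin Y.
      apply/negP => /(imset_f col); rewrite colY -cx !inE eqxx//.
    by rewrite /= -ltnS cY -cX (cardsD1 x X) xX.
  have sX := subsetDl X [set x]; split => //; apply/and3P; split.
  - by rewrite -cX (cardsD1 x X) xX.
  - exact: dominating_sub domX.
  - apply/eqP/setP => i; rewrite !inE; apply/imsetP/idP => [[y]|ii0].
      rewrite !inE => /andP[yx yX] ->; apply/negP => /eqP e.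
      by move: yx; rewrite (cinj y x) ?eqxx// e.
    have /imsetP[y yX iy] : i \in col @: X by rewrite cT.
    exists y => //; rewrite !inE yX andbT; apply: contra ii0 => /eqP e.
    by rewrite iy e cx.
have [->|[Y]] := set_0Vmem [set Y in doors | Y \subset X]; first by rewrite cards0.
rewrite !inE => /andP[/and3P[/eqP cY dY /eqP colY] sYX].
have [x xY eX] : exists2 x, x \notin Y & X = x |: Y.
  by apply: subset_succ_card => //; rewrite cX -cY.
have injY (Z : {set W}) : Z \in doors -> {in Z &, injective col}.
  rewrite inE => /and3P[/eqP cZ _ /eqP colZ].
  by apply/imset_injP; rewrite colZ cardsC1 -cZ.
have /imsetP[y yY cxy] : col x \in col @: Y.
  rewrite colY !inE; apply: contra cNT => /eqP cx.
  by rewrite eX imsetU1 colY cx setUCr.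
have xy : x != y by apply: contraNneq xY => ->.
have cX' : #|X :\ y|.+1 = #|I|.
  by rewrite -cX (cardsD1 y X) eX !inE yY orbT.
suff -> : [set Y in doors | Y \subset X] = [set X :\ x; X :\ y].
  rewrite cards2; suff -> : X :\ x != X :\ y by [].
  apply/eqP => /setP/(_ x); rewrite !inE eqxx xy /= eX !inE eqxx.
  by [].
have XxY : X :\ x = Y by rewrite eX setU1K.
have Xydoor : X :\ y \in doors.
  rewrite inE cX' eqxx /=; apply/andP; split.
    exact: dominating_sub (subsetDl _ _) domX.
  rewrite -colY; apply/eqP/setP => i; apply/imsetP/imsetP => -[z].
    rewrite eX !inE => /andP[zy /orP[/eqP->|zY] ->]; first by exists y.
    by exists z.
  move=> zY ->; have [->|zy] := eqVneq z y.
    by exists x; rewrite // eX !inE xy eqxx.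
  by exists z; rewrite // eX !inE zy zY orbT.
apply/setP => Z; rewrite in_set in_set2; apply/andP/orP; last first.
  case=> /eqP->; rewrite subsetDl; split => //.
  by rewrite XxY inE cY eqxx dY colY /=.
move=> [Zd sZX]; have := Zd; rewrite inE => /and3P[/eqP cZ dZ _].
have cards z : z \in X -> z \notin Z -> Z = X :\ z.
  move=> zX zZ; apply/eqP; rewrite eqEcard subsetD1 sZX zZ /=.
  by rewrite -ltnS cZ -cX (cardsD1 z X) zX.
have [xZ|xZ] := boolP (x \in Z); last first.
  by left; apply/eqP/cards => //; rewrite eX !inE eqxx.
have [yZ|yZ] := boolP (y \in Z); last first.
  by right; apply/eqP/cards => //; rewrite eX !inE yY orbT.
by have := injY _ Zd x y xZ yZ cxy => /eqP; rewrite (negbTE xy).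
Qed.

Let Y0 : {set W} := inr @: ~: [set i0].

(** In each order other than [i0] a slack vertex of [Y0] is lowest, so original vertices can be
    dominated in order [i0] only. This forces the added element to be the top vertex of [V] in that
    order. *)
Lemma outer_door_room : #|[set X in rooms | Y0 \subset X]| = 1%N.
Proof.
have [vm vmax] : exists vm, forall v, r i0 v <= r i0 vm.
  by case: (@arg_maxnP _ v0 predT (r i0) isT) => vm _ h; exists vm => v; apply: h.
have Y0card : #|Y0|.+1 = #|I|.
  rewrite card_imset; last by move=> ? ? [].
  by rewrite cardsC1 prednK//; apply/card_gt0P; exists i0.
have inlY0 v : (inl v \in Y0) = false by apply/imsetP => -[].
have inrY0 j : (inr j \in Y0) = (j != i0).
  by rewrite mem_imset ?inE//; move=> ? ? [].
rewrite (_ : [set _ in _ | _] = [set inl vm |: Y0]) ?cards1//.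
apply/setP => X; rewrite !inE; apply/andP/eqP => [[/andP[/eqP cX dX] sYX]|->].
  have [x xY eX] : exists2 x, x \notin Y0 & X = x |: Y0.
    by apply: subset_succ_card => //; rewrite cX -Y0card.
  subst X; move/dominatingP: dX => dX.
  case: x dX {cX sYX} xY => [v|j] dX; rewrite ?inlY0 ?inrY0.
    move=> _; suff -> : v = vm by [].
    have [i hi] := dX (inl vm).
    have ii0 : i = i0.
      apply/eqP; apply: contraT => ne; have := hi (inr i).
      by rewrite !inE inrY0 ne orbT => /(_ isT); rewrite /= eqxx.
    apply: (r_inj (i := i0)); apply/eqP; rewrite eqn_leq vmax//=.
    by have := hi (inl v); rewrite !inE eqxx ii0 => /(_ isT).
  rewrite negbK => /eqP e; subst j; have [i hi] := dX (inl v0).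
  have := hi (inr i); rewrite !inE inrY0.
  have [->|ne] := eqVneq i i0; rewrite ?eqxx ?orbT ?ne => /(_ isT) /=.
    by rewrite eqxx.
  by rewrite eqxx.
rewrite subsetUr cardsU1 inlY0 -Y0card eqxx; split => //=.
apply/dominatingP => -[v|j].
  exists i0 => x; rewrite !inE => /orP[/eqP->|]; first exact: vmax.
  case: x => [u|j]; rewrite ?inlY0 ?inrY0 //= => /negbTE->.
  exact: leq_ltn_trans (r_top i0 v) (ltnW (leq_addr _ _)).
by exists j => x _; rewrite /= eqxx.
Qed.

Lemma inner_door_rooms Y : Y \in doors -> Y != Y0 ->
  #|[set X in rooms | Y \subset X]| = 2.
Proof.
rewrite inE => /and3P[/eqP cY dY /eqP colY] YY0.
have [v vY] : exists v, inl v \in Y.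
  apply/existsP; apply: contraT; rewrite negb_exists => /forallP nY.
  case/negP: YY0; rewrite eqEcard; apply/andP; split.
    apply/subsetP => -[v|j] jY; first by have := nY v; rewrite jY.
    by rewrite mem_imset ?inE; [have := imset_f col jY; rewrite colY !inE|move=> ? ? []].
  rewrite card_imset; last by move=> ? ? [].
  by rewrite cardsC1 -cY.
rewrite -(@door_two_rooms _ _ R R_inj Y dY (esym cY) _ vY).
  by apply: eq_card => X; rewrite !inE andbC.
(* A door other than [Y0] contains an original vertex [v]; the slack vertex of [k] lies above [v] in
   all orders but [k], as [door_two_rooms] requires. *)
move=> k; exists (inr k) => l lk; exists (inl v) => //=.
by rewrite eq_sym (negbTE lk) (leq_trans _ (leq_addr _ _)) // !ltnS r_top.
Qed.

Lemma Scarf_slack : exists X, X \in rooms /\ col @: X = setT.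
Proof.
suff : odd #|[set X in rooms | col @: X == setT]|.
  case: (set_0Vmem [set X in rooms | col @: X == setT]) => [->|]; first by rewrite cards0.
  by move=> [X]; rewrite inE => /andP[? /eqP ?] _; exists X.
have Y0d : Y0 \in doors.
  have := outer_door_room => /eqP/cards1P[X /setP/(_ X)].
  rewrite set11 inE => /andP[]; rewrite !inE => /andP[_ dX] sX.
  rewrite [dom Y0](dominating_sub sX dX) card_imset; last by move=> ? ? [].
  rewrite cardsC1 prednK; last by apply/card_gt0P; exists i0.
  rewrite eqxx /= -imset_comp; apply/eqP/setP => j.
  apply/imsetP/idP => [[k kj ->]//|jj]; by exists j.
have -> : odd #|[set X in rooms | col @: X == setT]| =
    odd (\sum_(X in rooms) #|[set Y in doors | Y \subset X]|).
  rewrite -sum1_card (eq_bigl (fun X => (X \in rooms) && (col @: X == setT))); last first.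
    by move=> X; rewrite inE.
  rewrite big_mkcondr /=.
  apply: (big_ind2 (fun a b => odd a = odd b)) => //.
    by move=> a b a' b' h h'; rewrite !oddD h h'.
  by move=> X /room_doors->; case: ifP.
have -> : \sum_(X in rooms) #|[set Y in doors | Y \subset X]| =
    \sum_(Y in doors) #|[set X in rooms | Y \subset X]|.
  under eq_bigr => X _ do rewrite -sum1dep_card big_mkcondr/=.
  rewrite exchange_big /=; apply: eq_bigr => Y _.
  by rewrite -sum1dep_card [RHS]big_mkcondr.
rewrite (bigD1 Y0) //= outer_door_room oddD /=.
rewrite (eq_bigr (fun _ => 2)); last first.
  by move=> Y /andP[Yd YY0]; apply: inner_door_rooms.
by rewrite sum_nat_const oddM andbF.
Qed.

(** Drop the slack vertices from a fully colored room. If color [i] is carried by the slack vertex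
    [inr i], lowest in order [i], that order dominates no original vertex. So an order which does
    has its color on an original vertex. *)
Theorem Scarf : exists s : {set V}, s != set0 /\
  forall v, exists2 i, i \in c @: s & {in s, forall u, r i v <= r i u}.
Proof.
have [X []] := Scarf_slack; rewrite inE => /andP[_ /dominatingP dX] cX.
pose s := [set v | inl v \in X].
have hs v : exists2 i, i \in c @: s & {in s, forall u, r i v <= r i u}.
  have [i hi] := dX (inl v); exists i; last first.
    by move=> u; rewrite inE => /hi.
  have : i \in col @: X by rewrite cX.
  move=> /imsetP[[u|j] uX iu]; first by rewrite iu; apply/imset_f; rewrite inE.
  by have := hi _ uX; rewrite /= iu eqxx.
exists s; split => //; have [i /imsetP[u us _] _] := hs v0.
by apply/set0Pn; exists u.
Qed.

End Scarf.

(** * Scarf's lemma for the integer points of a dilated simplex *)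

Section Grid.
Context {d N : nat}.

Definition grid_point (v : {ffun 'I_d -> 'I_N.+1}) := \sum_i v i == N.

Lemma grid_exists (m : 'I_d -> nat) (i1 : 'I_d) : \sum_i m i <= N ->
  exists2 v : {ffun 'I_d -> 'I_N.+1}, grid_point v & forall i, m i <= v i.
Proof.
move=> mN; pose w i := m i + (i == i1) * (N - \sum_i m i).
have wN : \sum_i w i = N.
  have e : \sum_i (i == i1 : nat) = 1%N.
    by rewrite (bigD1 i1) //= eqxx big1 => [|i /negbTE->].
  by rewrite big_split /= -big_distrl /= e mul1n subnKC.
have wle i : w i < N.+1 by rewrite ltnS -[X in _ <= X]wN (bigD1 i) //= leq_addr.
exists [ffun i => Ordinal (wle i)].
  by rewrite /grid_point; under eq_bigr do rewrite ffunE /=; rewrite wN.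
by move=> i; rewrite ffunE /= leq_addr.
Qed.

(** Order [i] compares the coordinates [i]. If the minima [m i] over [s], counted as 0 for missing
    colors, added up to [N - d] or less, a grid point could exceed all of them by one and would not
    be dominated in the order of any color of [s]. So their sum is larger, and every coordinate of
    every point of [s] is less than [d] above its minimum. *)
Lemma grid_Scarf (c : {ffun 'I_d -> 'I_N.+1} -> 'I_d) : 0 < d ->
  exists2 v, grid_point v & forall i, v i < d \/
    exists u, [/\ grid_point u, c u = i &
      forall j, v j <= u j + d /\ u j <= v j + d].
Proof.
move=> d0; pose i1 := Ordinal d0.
pose V : finType := {v : {ffun 'I_d -> 'I_N.+1} | grid_point v}.
have [v0 v0N _] : exists2 v : {ffun 'I_d -> 'I_N.+1}, grid_point v & forall i, 0 <= v i.
  by apply: (grid_exists i1); rewrite big1.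
(* Orders must be injective: ties between equal coordinates are broken by the enumeration of [V]. *)
pose r (i : 'I_d) (v : V) := val v i * #|V| + enum_rank v.
have r_inj i : injective (r i).
  move=> u v /(congr1 (modn^~ #|V|)); rewrite /r !modnMDl !modn_small ?ltn_ord //.
  by move=> /ord_inj /enum_rank_inj.
have r_lt i (u v : V) : val u i < val v i -> r i u < r i v.
  move=> uv; apply: (@leq_trans ((val u i).+1 * #|V|)).
    by rewrite /r mulSn addnC ltn_add2r ltn_ord.
  by rewrite (leq_trans (leq_mul uv (leqnn _))) // /r leq_addr.
have [s [/set0Pn[v1 v1s] dom]] :=
  @Scarf V _ r r_inj (c \o val) i1 (exist _ v0 v0N).
pose C := (c \o val) @: s.
pose a i := [arg min_(v < v1 in s) val v i].
have as_ i : a i \in s by rewrite /a; case: arg_minnP.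
have amin i (v : V) : v \in s -> val (a i) i <= val v i.
  by rewrite /a; case: arg_minnP => // u us h /h.
pose m i : nat := if i \in C then (val (a i) i : nat) else 0.
have mN : N < \sum_i m i + d.
  rewrite ltnNge; apply/negP => h.
  have : \sum_i (m i + 1) <= N by rewrite big_split /= sum1_card card_ord.
  move=> /(grid_exists i1)[v vN mv].
  have [i iC hi] := dom (exist _ v vN).
  have := hi _ (as_ i); rewrite leqNgt => /negP; apply.
  by apply: r_lt => /=; have := mv i; rewrite addn1 /m iC.
have near (u : V) i : u \in s -> m i <= val u i < m i + d.
  move=> us; have mle j : m j <= val u j.
    by rewrite /m; case: ifP => // _; exact: amin.
  rewrite mle /=; have := mN.
  have uN : \sum_i (val u i : nat) = N by apply/eqP; exact: (valP u).
  rewrite -[X in X < _]uN.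
  rewrite (eq_bigr (fun j => m j + (val u j - m j))) => [|j _]; last first.
    by rewrite subnKC.
  rewrite big_split /= ltn_add2l => h.
  rewrite -ltn_subLR //; apply: leq_ltn_trans h.
  by rewrite (bigD1 i) //= leq_addr.
exists (val v1); first exact: valP.
move=> i; have [/imsetP[u us ->]|iC] := boolP (i \in C).
  right; exists (val u); split => // [|j]; first exact: valP.
  have /andP[h1 h2] := near _ j us.
  have /andP[h3 h4] := near _ j v1s.
  by split; [apply: leq_trans (ltnW h4) _|apply: leq_trans (ltnW h2) _];
     rewrite leq_add2r.
by left; have := near _ i v1s; rewrite /m (negbTE iC).
Qed.

End Grid.

From mathcomp Require Import all_order all_algebra.
From mathcomp Require Import all_classical all_reals all_analysis.
From mathcomp Require Import measurable_realfun ess_sup_inf.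
From mathcomp Require Import lra ring.
Import Order.TTheory GRing.Theory Num.Theory.
Import numFieldNormedType.Exports.
Local Open Scope classical_set_scope.
Local Open Scope ring_scope.

(** * Zeros of maps on the simplex *)

Section SimplexZero.
Context {R : realType} {d : nat}.
Implicit Types x u : 'I_d -> R.

Definition simplex x : Prop := (forall i, 0 <= x i) /\ \sum_i x i = 1.

Lemma simplex_le1 x i : simplex x -> x i <= 1.
Proof.
by move=> [x0 <-]; rewrite (bigD1 i) //= lerDl sumr_ge0.
Qed.

(** An approximate Knaster-Kuratowski-Mazurkiewicz lemma: on the grid of mesh [1 / n.+1] the integer
    distance [d] becomes [d / n.+1]. *)
Lemma simplex_KKM (c : ('I_d -> R) -> 'I_d) n : (0 < d)%N ->
  exists2 x, simplex x & forall i, x i <= d%:R / n.+1%:R \/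
    exists u, [/\ simplex u, c u = i &
      forall j, `|u j - x j| <= d%:R / n.+1%:R].
Proof.
move=> d0; pose pt (v : {ffun 'I_d -> 'I_n.+2}) i : R := (v i)%:R / n.+1%:R.
have ptS v : grid_point v -> simplex (pt v).
  move=> /eqP vn; split=> [i|]; first by rewrite divr_ge0.
  by rewrite -mulr_suml -natr_sum vn divff.
have [v vG hv] := @grid_Scarf d n.+1 (c \o pt) d0.
exists (pt v); first exact: ptS.
move=> i; have [vi|[u [uG cu vu]]] := hv i.
  by left; rewrite ler_pM2r ?invr_gt0// ler_nat ltnW.
right; exists (pt u); split => // [|j]; first exact: ptS.
have [h1 h2] := vu j.
rewrite /pt -mulrBl normrM [X in _ * X]ger0_norm ?invr_ge0//.
rewrite ler_pM2r ?invr_gt0// ler_distl -!natrD.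
by rewrite lerBlDr -natrD !ler_nat h1.
Qed.

Lemma simplex_cluster (x_ : nat -> 'I_d -> R) : (forall n, simplex (x_ n)) ->
  exists2 x, simplex x & forall (e : R) N, 0 < e ->
    exists2 n, (N <= n)%N & forall j, `|x_ n j - x j| < e.
Proof.
move=> xS; pose v n : 'rV[R]_d := \row_j x_ n j.
have cK : compact [set y : 'rV[R]_d | forall i, y ord0 i \in `[0, 1]].
  by apply: (@rV_compact R d (fun=> `[0 : R, 1 : R]%classic)) => i; apply: segment_compact.
have [y [_ yc]] : [set y : 'rV[R]_d | forall i, y ord0 i \in `[0, 1]] `&`
    cluster (v @ \oo) !=set0.
  apply: cK; exists 0%N => // n _ i /=; rewrite mxE in_itv/=.
  by rewrite (simplex_le1 i (xS n)) andbT; case: (xS n).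
have yP e N : 0 < e -> exists2 n, (N <= n)%N & forall j, `|x_ n j - y ord0 j| < e.
  move=> e0; have [||w [[n Nn <-] hw]] := yc [set v n | n in [set n | (N <= n)%N]] (ball y e).
  - by exists N => // n /= Nn; exists n.
  - exact: nbhsx_ballx.
  - have hw' i j : ball (y i j) e (v n i j) by move: hw => -[_ ].
    by exists n => // j; have := hw' ord0 j; rewrite -ball_normE/= mxE distrC.
exists (fun j => y ord0 j) => //; split => [i|].
  rewrite leNgt; apply/negP => y0.
  have /(yP _ 0%N)[n _ /(_ i)] : 0 < - y ord0 i by rewrite oppr_gt0.
  rewrite ltNge => /negP; apply; rewrite (le_trans _ (ler_norm _))// lerDr.
  by case: (xS n).
apply/eqP; rewrite -subr_eq0 -normr_le0 leNgt; apply/negP => s0.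
(* Dividing by [d.+1] instead of [d] makes [d] coordinate errors add up to strictly less than the
   defect of the sum. *)
have d0 : 0 < d.+1%:R :> R by [].
have /(yP _ 0%N)[n _ hn] := divr_gt0 s0 d0.
have : `|\sum_i y ord0 i - 1| <= \sum_(i < d) `|\sum_i y ord0 i - 1| / d.+1%:R.
  have [_ {1}<-] := xS n; rewrite -sumrB (le_trans (ler_norm_sum _ _ _))//.
  by apply: ler_sum => i _; rewrite distrC ltW.
by rewrite sumr_const card_ord -[_ *+ d]mulr_natr mulrAC ler_pdivlMr// ler_pM2l// ler_nat ltnn.
Qed.

(** Color each point by an index whose value there is nonnegative; one exists as the values sum to
    zero. A limit point of [simplex_KKM] is approached by points of every color [i] with [0 < x i],
    so by continuity and the boundary condition all values are nonnegative there, hence zero. *)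
Lemma simplex_zero (z : 'I_d -> ('I_d -> R) -> R) : (0 < d)%N ->
  (forall i (x_ : nat -> 'I_d -> R) x, (forall n, simplex (x_ n)) -> simplex x ->
    (forall j, x_ n j @[n --> \oo] --> x j) -> z i (x_ n) @[n --> \oo] --> z i x) ->
  (forall x, simplex x -> \sum_i z i x = 0) ->
  (forall i x, simplex x -> x i = 0 -> 0 <= z i x) ->
  exists2 x, simplex x & forall i, z i x = 0.
Proof.
move=> d0 zc z0 zb; pose i1 := Ordinal d0.
have cex x : exists i, simplex x -> 0 <= z i x.
  have [xS|] := pselect (simplex x); last by exists i1.
  have [i zi] : exists i, 0 <= z i x.
    apply: contrapT => /forallNP zn.
    have zlt i : z i x < 0 by rewrite ltNge; apply/negP/zn.
    have := z0 _ xS; rewrite (bigD1 i1) //=.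
    have : \sum_(i | i != i1) z i x <= 0 by rewrite sumr_le0// => i _; apply: ltW.
    by have := zlt i1; lra.
  by exists i.
have [c cP] := choice cex.
have Kex n := simplex_KKM c n d0.
pose x_ n := sval (cid2 (Kex n)).
have x_S n : simplex (x_ n) by rewrite /x_; case: cid2.
have x_P n i : x_ n i <= d%:R / n.+1%:R \/
    exists u, [/\ simplex u, c u = i & forall j, `|u j - x_ n j| <= d%:R / n.+1%:R].
  by rewrite /x_; case: cid2.
have [x xS xP] := simplex_cluster x_S.
exists x => //.
suff zge i : 0 <= z i x.
  move=> i; apply/eqP; rewrite eq_le zge andbT.
  have := z0 _ xS; rewrite (bigD1 i) //= => /eqP.
  by rewrite addr_eq0 => /eqP ->; rewrite oppr_le0 sumr_ge0.

have [xi0|xi0] := eqVneq (x i) 0; first exact: zb.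
have {}xi0 : 0 < x i by rewrite lt_def xi0 /=; case: xS.
have dn n : (0 : R) < n.+1%:R^-1 by [].
pose nk k := sval (cid2 (xP _ k (dn k))).
have nkk k : (k <= nk k)%N by rewrite /nk; case: cid2.
have xnk k j : `|x_ (nk k) j - x j| < k.+1%:R^-1 by rewrite /nk; case: cid2.
(* The error is at most [d / k.+1] from the grid and [1 / k.+1] from the subsequence. Once it is
   below [x i], the alternative of a small coordinate in [simplex_KKM] is excluded. *)
pose e k : R := d.+1%:R / k.+1%:R.
have e0 : e k @[k --> \oo] --> (0 : R).
  rewrite -[X in _ --> X](mulr0 (d.+1%:R : R)).
  by apply: cvgM; [exact: cvg_cst | exact: cvg_harmonic].
have uex k : exists u, [/\ simplex u, forall j, `|u j - x j| <= e k &
    e k < x i -> 0 <= z i u].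
  have dk : d%:R / (nk k).+1%:R <= d%:R / k.+1%:R :> R.
    by rewrite ler_wpM2l// lef_pV2 ?posrE// ler_nat ltnS.
  have [xi|[u [uS cu ux]]] := x_P (nk k) i.
    exists x; split => // [j|].
      by rewrite subrr normr0 divr_ge0.
    move=> ex; exfalso; move: ex; rewrite ltNge => /negP; apply.
    have := xnk k i; rewrite ltr_distlC => /andP[_ h].
    rewrite (le_trans (ltW h))// /e -[d.+1%:R]natr1 mulrDl mul1r lerD2r.
    exact: le_trans xi dk.
  exists u; split => // [j|_]; last by rewrite -cu; apply: cP.
  rewrite -(subrK (x_ (nk k) j) (u j)) -addrA (le_trans (ler_normD _ _))//.
  rewrite /e -[d.+1%:R]natr1 mulrDl mul1r lerD// ?(ltW (xnk k j))//.
  exact: le_trans (ux j) dk.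
have [u uP] := choice uex.
have uS k : simplex (u k) by case: (uP k).
have ux j : u k j @[k --> \oo] --> x j.
  apply/cvgrPdist_le => eps eps0; near=> k.
  rewrite distrC; case: (uP k) => _ /(_ j) h _; apply: le_trans h _.
  by near: k; move/cvgrPdist_le: e0 => /(_ _ eps0); apply: filterS => k;
    rewrite sub0r normrN; apply: le_trans; apply: ler_norm.
have zcv := zc i u x uS xS ux.
rewrite -(cvg_lim _ zcv)//; apply: limr_ge; first by apply/cvg_ex; exists (z i x).
near=> k; case: (uP k) => _ _; apply; near: k.
move/cvgrPdist_lt: (e0) => /(_ _ xi0).
by apply: filterS => k; rewrite sub0r normrN; apply: le_lt_trans; apply: ler_norm.
Unshelve. all: by end_near. Qed.

End SimplexZero.

(** * Market clearing in a single state *)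

Lemma cvg_finsum (R : realType) (d : nat) (u : nat -> 'I_d -> R) (l : 'I_d -> R) :
  (forall i, u n i @[n --> \oo] --> l i) ->
  \sum_i u n i @[n --> \oo] --> \sum_i l i.
Proof.
move=> ul; pose v i n := u n i.
rewrite (_ : (fun n => \sum_i u n i) = \sum_i v i); last first.
  by apply/funext => n; rewrite fct_sumE.
elim/big_ind2 : _ => [|v1 l1 v2 l2 h1 h2|i _]; [exact: cvg_cst|exact: cvgD|exact: ul].
Qed.

Section CappedDemand.
Context {R : realType}.
Implicit Types l a b : R.

Record inverse_marginal_utility (I : R -> R) : Prop := InverseMarginalUtility {
  imu_gt0 : forall y : R, 0 < y -> 0 < I y;
  imu_decr : forall y y' : R, 0 < y -> y < y' -> I y' < I y;
  imu_continuous : forall y : R, 0 < y -> I x @[x --> y] --> I y;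
  imu_pinfty : forall eps : R, 0 < eps ->
    exists2 K : R, 0 < K & forall y, K <= y -> I y < eps;
  imu_0 : forall M : R, exists2 k : R, 0 < k & forall y, 0 < y -> y <= k -> M < I y
}.

(* The consumption at which an agent with utility weight [l] and cap [G] equates
   weighted marginal utility and the state price [a]; it vanishes at [l = 0]. *)
Definition capped_demand (I : R -> R) (G l a : R) : R :=
  if (0 < l) && (0 < a) then Num.min G (I (a / l)) else 0.

Variables (I : R -> R) (G : R).
Hypotheses (hI : inverse_marginal_utility I) (G0 : 0 < G).

Lemma capped_demand_ge0 l a : 0 <= capped_demand I G l a.
Proof.
rewrite /capped_demand; case: ifP => // /andP[l0 a0].
by rewrite le_min (ltW G0) ltW// imu_gt0// divr_gt0.
Qed.

Lemma capped_demand_le l a : capped_demand I G l a <= G.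
Proof.
rewrite /capped_demand; case: ifP => [_|_]; last exact: ltW.
by rewrite ge_min lexx.
Qed.

Lemma capped_demand_decr l a b : 0 < a -> a <= b ->
  capped_demand I G l b <= capped_demand I G l a.
Proof.
move=> a0 ab; rewrite /capped_demand a0 (lt_le_trans a0 ab) !andbT.
case: ifP => // l0; rewrite le_min ge_min lexx/= ge_min.
move: ab; rewrite le_eqVlt => /predU1P[->|ab]; first by rewrite lexx orbT.
by rewrite (ltW (imu_decr hI _ _)) ?orbT// ?divr_gt0// ltr_pM2r// invr_gt0.
Qed.

(** [I] is strictly decreasing, so only a binding cap can keep demand from falling between two
    prices. *)
Lemma capped_demand_eq l a b : 0 < l -> 0 < a -> a < b ->
  capped_demand I G l a <= capped_demand I G l b -> G < I (a / l).
Proof.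
move=> l0 a0 ab; rewrite /capped_demand l0 a0 (lt_trans a0 ab)/=.
have : I (b / l) < I (a / l).
  by apply: (imu_decr hI); rewrite ?divr_gt0// ltr_pM2r// invr_gt0.
move=> h; rewrite le_min => /andP[_ hab]; rewrite ltNge; apply/negP => IG.
by move: hab; rewrite (min_idPr IG) leNgt h.
Qed.

Lemma capped_demand_cvg (l_ a_ : nat -> R) (l a : R) :
  (forall n, 0 <= l_ n) -> 0 <= l -> 0 < a ->
  l_ n @[n --> \oo] --> l -> a_ n @[n --> \oo] --> a ->
  capped_demand I G (l_ n) (a_ n) @[n --> \oo] --> capped_demand I G l a.
Proof.
move=> l_0 l0 a0 l_l a_a.
have a_0 : \forall n \near \oo, a / 2 < a_ n.
  by apply: (cvgr_gt a) => //; lra.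
move: l0; rewrite le_eqVlt => /predU1P[l0|l0].
  rewrite {2}/capped_demand -l0 ltxx/=; apply/cvgrPdist_lt => eps eps0.
  have [K K0 IK] := imu_pinfty hI eps0.
  (* With [a / 2 < a_ n] this makes [a_ n / l_ n] exceed [K]: demand fades out as the weight
     vanishes, in accordance with the value 0 at weight 0. *)
  have l_K : \forall n \near \oo, l_ n < a / 2 / K.
    by apply: (cvgr_lt l) => //; rewrite -l0 !divr_gt0.
  near=> n; rewrite sub0r normrN ger0_norm ?capped_demand_ge0//.
  rewrite /capped_demand; case: ifP => // /andP[l0n a0n].
  rewrite gt_min IK ?orbT// ler_pdivlMr// mulrC -ler_pdivlMr//.
  have h1 : l_ n < a / 2 / K by near: n.
  have h2 : a / 2 < a_ n by near: n.
  by rewrite (le_trans (ltW h1))// ler_pM2r ?invr_gt0// ltW.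
have l_0' : \forall n \near \oo, 0 < l_ n by apply: (cvgr_gt l).
have c : Num.min G (I (a_ n / l_ n)) @[n --> \oo] --> Num.min G (I (a / l)).
  apply: (@cvg_comp _ _ _ (fun n => I (a_ n / l_ n)) (Num.min G) _ (nbhs (I (a / l)))); last first.
    by apply: (@continuous_min _ _ (cst G) id); [exact: cvg_cst|exact: cvg_id].
  apply: (@cvg_comp _ _ _ (fun n => a_ n / l_ n) I _ (nbhs (a / l))); last first.
    by apply: imu_continuous => //; rewrite divr_gt0.
  by apply: cvgM => //; apply: cvgV => //; rewrite gt_eqF.
rewrite {2}/capped_demand l0 a0; apply: cvg_trans c; apply: near_eq_cvg.
near=> n; rewrite /capped_demand.
have -> : 0 < l_ n by near: n.
suff -> : 0 < a_ n by [].
rewrite (@lt_trans _ _ (a / 2))//; first by lra.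
by near: n.
Unshelve. all: by end_near. Qed.

End CappedDemand.

Section ClearingPrice.
Context {R : realType} {d : nat}.
Implicit Types (a : R) (l : 'I_d -> R).
Variables (I : 'I_d -> R -> R) (G e : 'I_d -> R) (K : R).
Hypotheses (d0 : (0 < d)%N) (hI : forall i, inverse_marginal_utility (I i)).
Hypotheses (G0 : forall i, 0 < G i) (e0 : forall i, 0 < e i) (K0 : 0 < K).
Hypothesis IK : forall i y, K <= y -> I i y < e i.

Definition aggregate_demand (l : 'I_d -> R) (a : R) : R :=
  \sum_i capped_demand (I i) (G i) (l i) a.

(** The largest clearing price, if there is one. The set is empty when the caps of the agents of
    positive weight add up to less than the supply; the price is then 0, the value of [sup] on the
    empty set. *)
Definition clearing_price (l : 'I_d -> R) : R :=
  sup [set a | 0 < a /\ \sum_i e i <= aggregate_demand l a].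

Notation S := aggregate_demand.
Notation p := clearing_price.
Let s := \sum_i e i.

Let S_decr l a b : 0 < a -> a <= b -> S l b <= S l a.
Proof. by move=> a0 ab; apply: ler_sum => i _; apply: capped_demand_decr. Qed.

(** Weights are at most one, so [K <= a] implies [K <= a / l i], and every agent demands less than
    its endowment. *)
Let S_K l a : simplex l -> K <= a -> S l a < s.
Proof.
move=> lS Ka; rewrite /S /s; apply: ltr_sum; last first.
  move=> i _; rewrite /capped_demand; case: ifP => // /andP[l0 a0].
  rewrite gt_min IK ?orbT// (le_trans Ka)// ler_pdivlMr//.
  by rewrite -[leRHS]mulr1 ler_pM2l// simplex_le1.
by apply/hasP; exists (Ordinal d0) => //; rewrite mem_index_enum.
Qed.

Let set_le l a : simplex l -> 0 < a -> S l a < s ->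
  ubound [set a | 0 < a /\ s <= S l a] a.
Proof.
move=> lS a0 Sa b [b0 sb]; rewrite leNgt; apply/negP => ab.
by have := S_decr l a0 (ltW ab); lra.
Qed.

Let has_ubK l : simplex l -> has_ubound [set a | 0 < a /\ s <= S l a].
Proof. by move=> lS; exists K; apply: set_le => //; apply: S_K. Qed.

Lemma clearing_price_ge l a : simplex l -> 0 < a -> s <= S l a -> a <= p l.
Proof. by move=> lS a0 sa; apply: ub_le_sup => //; apply: has_ubK. Qed.

Lemma clearing_price_ge0 l : simplex l -> 0 <= p l.
Proof.
move=> lS; rewrite /p -/s.
have [->|/set0P[a [a0 sa]]] := eqVneq [set a | 0 < a /\ s <= S l a] set0; first by rewrite sup0.
exact: le_trans (ltW a0) (clearing_price_ge lS a0 sa).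
Qed.

Lemma clearing_price_le l a : simplex l -> 0 < a -> S l a < s -> p l <= a.
Proof.
move=> lS a0 Sa; rewrite /p -/s.
have [->|/set0P n0] := eqVneq [set a | 0 < a /\ s <= S l a] set0; first by rewrite sup0 ltW.
by apply: sup_le_ub => //; apply: set_le.
Qed.

Lemma clearing_price_leK l : simplex l -> p l <= K.
Proof. by move=> lS; apply: clearing_price_le => //; apply: S_K. Qed.

(** The rational witness turns superlevel sets of the price into countable unions, for measurability
    in the state. *)
Lemma clearing_price_gtP l a : simplex l -> 0 <= a ->
  a < p l <-> exists q : rat, a < ratr q /\ s <= S l (ratr q).
Proof.
move=> lS a0; split=> [ap|[q [aq sq]]]; last first.
  have q0 : 0 < (ratr q : R) by apply: le_lt_trans aq.
  exact: lt_le_trans (clearing_price_ge lS q0 sq).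
have [b [b0 sb] ab] : exists2 b, (0 < b /\ s <= S l b) & a < b.
  apply: sup_gt => //; apply/set0P/eqP => e1; move: ap.
  by rewrite /p -/s e1 sup0 ltNge a0.
have [q /andP[aq qb]] := rat_in_itvoo ab.
exists q; split => //; apply: le_trans sb _; apply: S_decr; last exact: ltW.
by apply: le_lt_trans aq.
Qed.

Let S_cvg (l_ : nat -> 'I_d -> R) l (a_ : nat -> R) a :
  (forall n, simplex (l_ n)) -> simplex l -> 0 < a ->
  (forall i, l_ n i @[n --> \oo] --> l i) -> a_ n @[n --> \oo] --> a ->
  S (l_ n) (a_ n) @[n --> \oo] --> S l a.
Proof.
move=> l_S lS a0 l_l a_a; apply: cvg_finsum => i.
apply: capped_demand_cvg => // [n|]; [by case: (l_S n) | by case: lS].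
Qed.

Lemma aggregate_demand_clearing_price l : simplex l -> 0 < p l -> S l (p l) = s.
Proof.
move=> lS p0; apply/eqP; rewrite eq_le; apply/andP; split.
  have c : S l (p l + n.+1%:R^-1) @[n --> \oo] --> S l (p l).
    apply: S_cvg => // [i|]; first exact: cvg_cst.
    rewrite -[X in _ --> X]addr0; apply: cvgD; first exact: cvg_cst.
    exact: cvg_harmonic.
  rewrite -(cvg_lim _ c)//; apply: limr_le; first by apply/cvg_ex; exists (S l (p l)).
  near=> n; rewrite leNgt; apply/negP => h.
  have n0 : 0 < (n.+1%:R^-1 : R) by [].
  have pn : 0 < p l + n.+1%:R^-1 by rewrite addr_gt0.
  have := clearing_price_ge lS pn (ltW h).
  by rewrite gerDl leNgt n0.
(* Approach from below, where demand is at least the supply; with [n.+2] the price is positive for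
   [n = 0] too. *)
have c : S l (p l - p l / n.+2%:R) @[n --> \oo] --> S l (p l).
  apply: S_cvg => // [i|]; first exact: cvg_cst.
  rewrite -[X in _ --> X]subr0; apply: cvgB; first exact: cvg_cst.
  rewrite -[X in _ --> X](mulr0 (p l)); apply: cvgM; first exact: cvg_cst.
  by have := @cvg_harmonic R; rewrite -cvg_shiftS.
rewrite -(cvg_lim _ c)//; apply: limr_ge; first by apply/cvg_ex; exists (S l (p l)).
near=> n.
have n0 : 0 < p l / n.+2%:R by rewrite divr_gt0.
have n1 : 0 < p l - p l / n.+2%:R.
  by rewrite subr_gt0 ltr_pdivrMr// ltr_pMr// ltr1n.
have /(clearing_price_gtP lS (ltW n1))[q [nq sq]] : p l - p l / n.+2%:R < p l.
  by rewrite gtrDl oppr_lt0.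
by apply: le_trans sq _; apply: S_decr => //; apply: ltW.
Unshelve. all: by end_near. Qed.

(** Strict inequalities between demand and supply persist under small changes of weights. Above the
    largest clearing price demand is strictly less than supply; below it, equality may occur, and
    there the caps help. *)
Lemma clearing_price_cvg (l_ : nat -> 'I_d -> R) l :
  (forall n, simplex (l_ n)) -> simplex l ->
  (forall i, l_ n i @[n --> \oo] --> l i) -> p (l_ n) @[n --> \oo] --> p l.
Proof.
move=> l_S lS l_l.
have up a : p l < a -> \forall n \near \oo, p (l_ n) <= a.
  move=> pa; have a0 := le_lt_trans (clearing_price_ge0 lS) pa.
  have Sa : S l a < s.
    rewrite ltNge; apply/negP => /(clearing_price_ge lS a0).
    by rewrite leNgt pa.
  have : \forall n \near \oo, S (l_ n) a < s.
    by apply: (cvgr_lt (S l a)) => //; apply: S_cvg => //; exact: cvg_cst.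
  by apply: filterS => n; apply: clearing_price_le.
have down a : a < p l -> \forall n \near \oo, a <= p (l_ n).
  move=> ap; have [a0|a0] := lerP a 0.
    by near=> n; apply: (le_trans a0); apply: clearing_price_ge0.
  have [q [aq sq]] := (clearing_price_gtP lS (ltW a0)).1 ap.
  have Sqa := S_decr l a0 (ltW aq).
  have [Sa|Sa] := ltP s (S l a).
    have : \forall n \near \oo, s < S (l_ n) a.
      by apply: (cvgr_gt (S l a)) => //; apply: S_cvg => //; exact: cvg_cst.
    by apply: filterS => n /ltW; apply: clearing_price_ge.
  (* both prices clear the market, so every agent with positive weight is capped *)
  have dec i := capped_demand_decr (G i) (hI i) (l i) a0 (ltW aq).
  have eqi i : capped_demand (I i) (G i) (l i) a = capped_demand (I i) (G i) (l i) (ratr q).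
    have : \sum_i (capped_demand (I i) (G i) (l i) a -
        capped_demand (I i) (G i) (l i) (ratr q)) = 0.
      by rewrite sumrB -/(S l a) -/(S l (ratr q)); lra.
    move=> /psumr_eq0P/(_ i isT) h; apply/eqP; rewrite -subr_eq0 h//.
    by move=> j _; rewrite subr_ge0.
  (* Agents of weight zero demand nothing at [l], and capped agents satisfy the strict inequality
     [G i < I i (a / l i)], which survives a change of weights. So demand at [a] does not drop. *)
  have : \forall n \near \oo, forall i,
      capped_demand (I i) (G i) (l i) a <= capped_demand (I i) (G i) (l_ n i) a.
    apply: filter_forall => i.
    have [li|li] := lerP (l i) 0.
      near=> n; rewrite {1}/capped_demand ltNge li/=.
      exact: capped_demand_ge0.
    have GI : G i < I i (a / l i).
      by apply: (capped_demand_eq (hI i) li a0 aq); rewrite eqi.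
    have c : I i (a / l_ n i) @[n --> \oo] --> I i (a / l i).
      apply: (@cvg_comp _ _ _ (fun n => a / l_ n i) (I i) _ (nbhs (a / l i))); last first.
        by apply: imu_continuous => //; rewrite divr_gt0.
      by apply: cvgM; [exact: cvg_cst|apply: cvgV => //; rewrite gt_eqF].
    have h1 : \forall n \near \oo, G i < I i (a / l_ n i) by apply: (cvgr_gt _ c).
    have h2 : \forall n \near \oo, 0 < l_ n i by apply: (cvgr_gt (l i)).
    near=> n; apply: le_trans (capped_demand_le (I i) (G0 i) _ _) _.
    rewrite /capped_demand a0; have -> : 0 < l_ n i by near: n.
    by rewrite le_min lexx/= ltW//; near: n.
  apply: filterS => n h; apply: clearing_price_ge => //.
  by apply: (le_trans sq); apply: (le_trans Sqa); apply: ler_sum => i _.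
apply/cvgrPdist_le => eps eps0; near=> n.
rewrite ler_distlC; apply/andP; split.
  by near: n; apply: down; lra.
by near: n; apply: up; lra.
Unshelve. all: by end_near. Qed.

(** At price zero demand may jump, but expenditure is at most the price times the cap, hence tends
    to zero. *)
Lemma clearing_price_demand_cvg (l_ : nat -> 'I_d -> R) l i :
  (forall n, simplex (l_ n)) -> simplex l ->
  (forall i, l_ n i @[n --> \oo] --> l i) ->
  p (l_ n) * capped_demand (I i) (G i) (l_ n i) (p (l_ n)) @[n --> \oo] -->
  p l * capped_demand (I i) (G i) (l i) (p l).
Proof.
move=> l_S lS l_l; have p_p := clearing_price_cvg l_S lS l_l.
have := clearing_price_ge0 lS; rewrite le_eqVlt => /predU1P[p0|p0]; last first.
  apply: cvgM => //; apply: capped_demand_cvg => // [n|]; [by case: (l_S n)|by case: lS].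
rewrite -p0 mul0r; apply: (@squeeze_cvgr _ _ _ _ (fun=> 0) (fun n => p (l_ n) * G i)).
- near=> n; have pn := clearing_price_ge0 (l_S n).
  by rewrite mulr_ge0 ?capped_demand_ge0//= ler_wpM2l// capped_demand_le.
- exact: cvg_cst.
- by rewrite -[X in _ --> X](mul0r (G i)) p0; apply: cvgM => //; exact: cvg_cst.
Unshelve. all: by end_near. Qed.

(** At the price [k * l j], with [I j k] above the cap, agent [j] alone demands [G j] and thus the
    whole supply. *)
Lemma clearing_price_gt0_cap l j : simplex l -> 0 < l j -> s <= G j -> 0 < p l.
Proof.
move=> lS lj sG; have [k k0 kI] := imu_0 (hI j) (G j).
have a0 : 0 < k * l j by rewrite mulr_gt0.
apply: (lt_le_trans a0 (clearing_price_ge lS a0 _)).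
apply: (le_trans sG); rewrite /aggregate_demand (bigD1 j)//=.
rewrite -[leLHS]addr0 lerD//; last by apply: sumr_ge0 => i _; apply: capped_demand_ge0.
rewrite /capped_demand lj a0/= le_min lexx/= mulfK ?gt_eqF//.
by rewrite ltW// kI.
Qed.

Lemma clearing_price_gt0 l : simplex l -> (forall i, 0 < l i) -> s <= \sum_i G i -> 0 < p l.
Proof.
move=> lS l0 sG.
have kex i : exists k, 0 < k /\ forall y, 0 < y -> y <= k -> G i < I i y.
  by have [k k0 hk] := imu_0 (hI i) (G i); exists k.
have [k kP] := choice kex.
have [a a0 ak] : exists2 a : R, 0 < a & forall i, a <= k i * l i.
  exists (\big[Num.min/1]_i (k i * l i)).
    by apply/bigmin_gtP; split => // i _; rewrite mulr_gt0//; case: (kP i).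
  by move=> i; apply: bigmin_le_cond.
apply: (lt_le_trans a0 (clearing_price_ge lS a0 _)).
apply: (le_trans sG); apply: ler_sum => i _; rewrite /capped_demand l0 a0 le_min lexx/=.
by rewrite ltW//; case: (kP i) => _; apply; rewrite ?divr_gt0// ler_pdivrMr.
Qed.

End ClearingPrice.

(** * Regular utility functions *)

(** If [u x'] lay above the tangent, concavity would keep the difference quotients along the segment
    from [x] to [x'] above the slope by a fixed amount, against their convergence to the
    derivative. *)
Lemma concave_tangent (R : realType) (u : R -> R) (x x' : R) :
  strictly_concave_on [set` `]0, +oo[] u -> 0 < x -> 0 < x' ->
  derivable u x 1 -> u x' <= u x + derive1 u x * (x' - x).
Proof.
move=> uc x0 x'0 du; have [->|xx'] := eqVneq x x'; first by rewrite subrr mulr0 addr0.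
rewrite leNgt; apply/negP => gap.
pose v := x' - x; have v0 : 0 < `|v| by rewrite normr_gt0 subr_eq0 eq_sym.
pose eps := (u x' - u x - derive1 u x * v) / `|v|.
have eps0 : 0 < eps.
  by rewrite divr_gt0// /v; move: gap; set w := _ * _; lra.
have : (fun h => h^-1 *: (u (h + x) - u x)) @ 0^' --> derive1 u x.
  have := du; rewrite derive1E /derive /derivable => c.
  apply: cvg_trans c; apply: near_eq_cvg; near=> h.
  by rewrite /= scaler1.
move=> /cvgrPdist_lt/(_ _ eps0); rewrite near_withinE => /nbhs_ballP[r /= r0 hr].
(* A proper convex combination whose step [t * v] stays within the radius [r]. *)
pose t := Num.min 2^-1 (r / 2 / `|v|).
have t0 : 0 < t by rewrite lt_min invr_gt0 ltr0n/= !divr_gt0.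
have t1 : t < 1 by rewrite gt_min invf_lt1// ltr1n.
have tv : `|t * v| < r.
  rewrite normrM gtr0_norm// -ltr_pdivlMr// gt_min; apply/orP; right.
  by rewrite ltr_pM2r ?invr_gt0//; lra.
have := hr (t * v); rewrite -ball_normE/= sub0r normrN => /(_ tv).
rewrite mulf_neq0 ?(gt_eqF t0)// ?subr_eq0 1?eq_sym// => /(_ isT) q.
have c : t * u x' + (1 - t) * u x < u (t * v + x).
  have -> : t * v + x = t * x' + (1 - t) * x by rewrite /v; ring.
  by apply: uc; rewrite //= ?in_itv/= ?andbT// eq_sym.
have vn0 : v != 0 by rewrite subr_eq0 eq_sym.
move: q; rewrite -(ltr_pM2l v0) -normrM /eps mulrCA divff ?gt_eqF// mulr1.
have -> : v * (derive1 u x - (t * v)^-1 * (u (t * v + x) - u x)) =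
    derive1 u x * v - t^-1 * (u (t * v + x) - u x).
  by field; rewrite vn0 gt_eqF.
rewrite ltr_norml => /andP[q _].
have : t^-1 * (u (t * v + x) - u x) < u x' - u x by lra.
by rewrite mulrC ltr_pdivrMr//; lra.
Unshelve. all: by end_near. Qed.

Section UtilityExt.
Context {R : realType}.
Variable u : R -> R.
Hypothesis u_incr : forall x y : R, 0 < x -> x < y -> u x < u y.

Lemma utility_ext_le0 (c : R) : c <= 0 ->
  utility_ext u c = ereal_inf [set (u z)%:E | z in [set` `]0, +oo[]].
Proof.
move=> c0; rewrite /utility_ext ltNge c0/=; apply: cvg_lim => //.
apply: (@nondecreasing_at_right_cvge R (fun z => (u z)%:E) 0 (BInfty _ false)) => //.
move=> x y; rewrite !in_itv/= !andbT => x0 y0; rewrite le_eqVlt => /predU1P[->//|xy].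
by rewrite lee_fin ltW// u_incr.
Qed.

Lemma utility_ext_lt (c z : R) : 0 < z -> c < z -> (utility_ext u c <= (u z)%:E)%E.
Proof.
move=> z0 cz; have [c0|c0] := ltP 0 c.
  by rewrite /utility_ext c0 lee_fin ltW// u_incr.
rewrite utility_ext_le0//; apply: ereal_inf_lbound; exists z => //=.
by rewrite in_itv/= z0.
Qed.

Lemma utility_ext_ltP (c : R) (b : \bar R) : {in `]0, +oo[, continuous u} ->
  (utility_ext u c < b)%E <->
  exists q : rat, [/\ 0 < ratr q :> R, c < ratr q & ((u (ratr q))%:E < b)%E].
Proof.
move=> uc; split=> [|[q [q0 cq ub]]]; last exact: le_lt_trans (utility_ext_lt q0 cq) ub.
have [c0|c0] := ltP 0 c; last first.
  rewrite utility_ext_le0// => /ereal_inf_lt[_ [z /= z0 <-] uzb].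
  move: z0; rewrite in_itv/= andbT => z0.
  have [q /andP[q0 qz]] := rat_in_itvoo z0.
  exists q; split => //; first exact: le_lt_trans q0.
  by apply: le_lt_trans uzb; rewrite lee_fin ltW// u_incr.
rewrite /utility_ext c0 => ucb.
have : \forall x \near c, ((u x)%:E < b)%E.
  have ucx : u x @[x --> c] --> u c by apply: uc; rewrite in_itv/= c0.
  case: b ucb => [b||//]; rewrite ?lte_fin => ucb.
    by near=> x; rewrite lte_fin; near: x; apply: (cvgr_lt (u c)).
  by near=> x; rewrite ltry.
move=> /nbhs_ballP[r /= r0 hr].
have [q /andP[cq qr]] : exists q : rat, (ratr q : R) \in `]c, (c + r)[.
  by apply: rat_in_itvoo; rewrite ltrDl.
exists q; split => //; first exact: lt_trans cq.
by apply: hr; rewrite /ball/= distrC gtr0_norm ?subr_gt0// ltrBlDl.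
Unshelve. all: by end_near. Qed.

Lemma utility_ext_tangent (c x : R) : strictly_concave_on [set` `]0, +oo[] u ->
  0 < x -> derivable u x 1 -> 0 < derive1 u x -> 0 <= c ->
  (utility_ext u c <= (u x + derive1 u x * (c - x))%:E)%E.
Proof.
move=> uc x0 du u'0; rewrite le_eqVlt => /predU1P[<-|c0]; last first.
  by rewrite /utility_ext c0 lee_fin concave_tangent.
(* At consumption 0 the value is bounded by that at a small [z], chosen so that the tangent rises by
   exactly [eps] between 0 and [z]. *)
apply/lee_addgt0Pr => eps eps0; pose z := eps / derive1 u x.
have z0 : 0 < z by rewrite divr_gt0.
apply: (le_trans (utility_ext_lt z0 z0)); rewrite -EFinD lee_fin.
apply: (le_trans (concave_tangent uc x0 z0 du)).
have : derive1 u x * z = eps by rewrite /z mulrCA divff ?gt_eqF// mulr1.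
by rewrite !mulrBr; lra.
Qed.

End UtilityExt.

Section RegularUtility.
Context {R : realType} (T : R) (U I : R -> R -> R).
Hypothesis hU : regular_utility T U.
Hypothesis hI : inverse_marginal T U I.
Hypothesis lI : locally_convexity_Lipschitz T [set` `]0, +oo[] I.

(** Add the tangent inequalities of [U t] at [I t y] and [I t y'], where the slopes are [y] and
    [y']. *)
Lemma inverse_marginal_decr t (y y' : R) : t \in `[0, T] -> 0 < y -> y < y' -> I t y' < I t y.
Proof.
move=> tT y0 yy'; have y'0 := lt_trans y0 yy'.
have [_ Ipos _ Iinv] := hI tT.
rewrite ltNge; apply/negP => Iyy'.
have [e|ne] := eqVneq (I t y) (I t y').
  by have := Iinv _ y0; rewrite e Iinv// => e'; move: yy'; rewrite e' ltxx.
have du x : 0 < x -> derivable (U t) x 1.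
  by move=> x0; have [h _] := utility_C1 hU tT; apply: h; rewrite /= in_itv/= x0.
have sc := utility_strictly_concave hU tT.
have := concave_tangent sc (Ipos _ y0) (Ipos _ y'0) (du _ (Ipos _ y0)).
have := concave_tangent sc (Ipos _ y'0) (Ipos _ y0) (du _ (Ipos _ y'0)).
rewrite !Iinv// => h1 h2.
have : 0 < I t y' - I t y by rewrite subr_gt0 lt_neqAle ne.
have : 0 <= (y - y') * (I t y' - I t y) by lra.
by move=> h3 h4; move: h3; rewrite pmulr_lge0// subr_ge0 leNgt yy'.
Qed.

Lemma inverse_marginal_continuous t (y : R) : t \in `[0, T] -> 0 < y -> I t x @[x --> y] --> I t y.
Proof.
move=> tT y0; have [] := lI (x1 := y / 2) (x2 := y * 2).
- by lra.
- by move=> x /=; rewrite !in_itv/= andbT => /andP[h _]; apply: lt_le_trans h; lra.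
move=> /(_ _ tT)[dI _] _ _.
apply: differentiable_continuous; apply/derivable1_diffP; apply: dI.
by rewrite /= in_itv/=; apply/andP; split; lra.
Qed.

(** The total convexity norm contains the absolute value at the left endpoint, so an interval
    starting at [y] is used. *)
Lemma inverse_marginal_Lipschitz (y : R) : 0 < y ->
  exists C : R, forall t s, t \in `[0, T] -> s \in `[0, T] -> `|I t y - I s y| <= C * `|t - s|.
Proof.
move=> y0; have [] := lI (x1 := y) (x2 := y + 1).
- by lra.
- by move=> x /=; rewrite !in_itv/= andbT => /andP[h _]; apply: lt_le_trans h.
move=> _ _ [C hC]; exists C => t s tT sT; rewrite -lee_fin.
apply: le_trans (hC _ _ tT sT); rewrite /total_convexity_norm -addeA.
by rewrite leeDl// adde_ge0// total_variation_ge0//; lra.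
Qed.

Hypothesis I0 : forall M : R, \forall y \near 0^'+, forall t : R, t \in `[0, T] -> M < I t y.
Hypothesis Ioo : forall eps : R, 0 < eps ->
  \forall y \near +oo, forall t : R, t \in `[0, T] -> `|I t y| < eps.

Lemma inverse_marginal_pinfty eps : 0 < eps ->
  exists2 K : R, 0 < K & forall t y, t \in `[0, T] -> K <= y -> I t y < eps.
Proof.
move=> eps0; have [M [_ hM]] := Ioo eps0.
exists (Num.max M 0 + 1) => [|t y tT My].
  by rewrite ltr_wpDl// le_max lexx orbT.
apply: le_lt_trans (ler_norm _) (hM _ _ _ tT).
by apply: lt_le_trans My; rewrite ltr_pwDr// le_max lexx.
Qed.

Lemma regular_inverse_marginal_utility t : t \in `[0, T] -> inverse_marginal_utility (I t).
Proof.
move=> tT; split.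
- by case: (hI tT).
- by move=> y y'; apply: inverse_marginal_decr.
- by move=> y; apply: inverse_marginal_continuous.
- by move=> eps /inverse_marginal_pinfty[K K0 hK]; exists K => // y; apply: hK.
- move=> M; have := I0 M; rewrite near_withinE => /nbhs_ballP[r /= r0 hr].
  exists (r / 2) => [|y y0 yr]; first by lra.
  by apply: hr => //; rewrite -ball_normE/= sub0r normrN gtr0_norm//; lra.
Qed.

End RegularUtility.

(** * Measurability of optional processes *)

Section MeasurableFun.
Context {disp : measure_display} {S : measurableType disp} {R : realType}.
Implicit Type D : set S.

Lemma measurable_fun_gt D (f : S -> R) : measurable D ->
  (forall b : R, measurable (D `&` [set x | b < f x])) -> measurable_fun D f.
Proof.
move=> mD h; apply: (measurability (@RGenOInfty.G R)); first exact: RGenOInfty.measurableE.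
move=> _ [_ [b ->] <-]; rewrite (_ : _ @^-1` _ = [set x | b < f x]); first exact: h.
by apply/seteqP; split => x /=; rewrite in_itv/= andbT.
Qed.

Lemma emeasurable_fun_lt D (f : S -> \bar R) : measurable D ->
  (forall b : R, measurable (D `&` [set x | (f x < b%:E)%E])) -> measurable_fun D f.
Proof.
move=> mD h; apply: (measurability (@ErealGenInftyO.G R)); first exact: ErealGenInftyO.measurableE.
move=> _ [_ [b ->] <-]; rewrite (_ : _ @^-1` _ = [set x | (f x < b%:E)%E]); first exact: h.
by apply/seteqP; split => x /=; rewrite in_itv.
Qed.

Lemma emeasurable_fun_gt D (f : S -> \bar R) : measurable D ->
  (forall b : R, measurable (D `&` [set x | (b%:E < f x)%E])) -> measurable_fun D f.
Proof.
move=> mD h; apply: (measurability (@ErealGenOInfty.G R)); first exact: ErealGenOInfty.measurableE.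
move=> _ [_ [b ->] <-]; rewrite (_ : _ @^-1` _ = [set x | (b%:E < f x)%E]); first exact: h.
by apply/seteqP; split => x /=; rewrite in_itv/= andbT.
Qed.

Lemma measurable_fun_ifD {d' : measure_display} {S' : measurableType d'} D
    (c : S -> bool) (f g : S -> S') : measurable D -> measurable_fun D c ->
  measurable_fun D f -> measurable_fun D g ->
  measurable_fun D (fun x => if c x then f x else g x).
Proof.
move=> mD mc mf mg; apply: measurable_fun_if => //.
  by apply: measurable_funS mf => //; exact: subIsetl.
by apply: measurable_funS mg => //; exact: subIsetl.
Qed.

Lemma measurable_setI_lt D (f g : S -> R) : measurable D ->
  measurable_fun D f -> measurable_fun D g ->
  measurable (D `&` [set x | f x < g x]).
Proof.
move=> mD mf mg; rewrite (_ : [set x | _] = (fun x => f x < g x) @^-1` [set true]).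
  by apply: measurable_fun_ltr => //.
by apply/seteqP; split.
Qed.

Lemma measurable_setI_le D (f g : S -> R) : measurable D ->
  measurable_fun D f -> measurable_fun D g ->
  measurable (D `&` [set x | f x <= g x]).
Proof.
move=> mD mf mg; rewrite (_ : [set x | _] = (fun x => f x <= g x) @^-1` [set true]).
  by apply: measurable_fun_ler => //.
by apply/seteqP; split.
Qed.

(* Evaluating a function which is measurable in one variable and decreasing and
   right-continuous in the other one: [b < f x (r x)] iff [b < f x q] for some
   rational [q > r x]. *)
Lemma measurable_fun_decr_comp D (f : S -> R -> R) (r : S -> R) : measurable D ->
  (forall q : R, 0 < q -> measurable_fun D (f ^~ q)) ->
  (forall x (y y' : R), D x -> 0 < y -> y < y' -> f x y' < f x y) ->
  (forall x (y : R), D x -> 0 < y -> f x y' @[y' --> y] --> f x y) ->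
  measurable_fun D r -> (forall x, D x -> 0 < r x) ->
  measurable_fun D (fun x => f x (r x)).
Proof.
move=> mD mf fdec fc mr r0; apply: measurable_fun_gt => // b.
rewrite (_ : _ `&` _ = \bigcup_(q in [set q : rat | 0 < (ratr q : R)])
    ((D `&` [set x | r x < ratr q]) `&` (D `&` [set x | b < f x (ratr q)]))); last first.
  apply/seteqP; split => x /=; last first.
    move=> [q /= q0 [[Dx rq] [_ bf]]]; split => //.
    by apply: lt_trans bf _; apply: fdec => //; exact: r0.
  move=> [Dx bf]; have rx := r0 _ Dx.
  have : \forall y \near r x, b < f x y by exact: (cvgr_gt _ (fc x (r x) Dx rx)).
  move=> /nbhs_ballP[e /= e0 he].
  have [q /andP[rq qe]] : exists q : rat, (ratr q : R) \in `]r x, (r x + e)[.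
    by apply: rat_in_itvoo; rewrite ltrDl.
  exists q; first exact: lt_trans rq.
  split; split => //=; apply: he.
  by rewrite -ball_normE/= distrC gtr0_norm ?subr_gt0// ltrBlDl.
rewrite bigcup_mkcond; apply: bigcupT_measurable_rat => q; case: ifPn => // /set_mem /= q0.
apply: measurableI; first exact: measurable_setI_lt.
by apply: measurable_setI_lt => //; exact: mf.
Qed.

(** By [utility_ext_ltP], sublevel sets are countable unions over rational consumption levels above
    [c], so measurability of [u] at fixed levels suffices. *)
Lemma measurable_fun_utility_ext D (u : S -> R -> R) (c : S -> R) : measurable D ->
  (forall q : R, 0 < q -> measurable_fun D (u ^~ q)) ->
  (forall x (y y' : R), D x -> 0 < y -> y < y' -> u x y < u x y') ->
  (forall x, D x -> {in `]0, +oo[, continuous (u x)}) ->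
  measurable_fun D c ->
  measurable_fun D (fun x => utility_ext (u x) (c x)).
Proof.
move=> mD mu uinc uc mc; apply: emeasurable_fun_lt => // b.
rewrite (_ : _ `&` _ = \bigcup_(q in [set q : rat | 0 < (ratr q : R)])
    ((D `&` [set x | c x < ratr q]) `&` (D `&` [set x | u x (ratr q) < b]))); last first.
  apply/seteqP; split => x /=; last first.
    move=> [q /= q0 [[Dx cq] [_ ub]]]; split => //.
    by apply/(utility_ext_ltP (fun y y' => uinc x y y' Dx) _ _ (uc x Dx)); exists q.
  move=> [Dx /(utility_ext_ltP (fun y y' => uinc x y y' Dx) _ _ (uc x Dx))[q [q0 cq]]].
  by rewrite lte_fin => ub; exists q.
rewrite bigcup_mkcond; apply: bigcupT_measurable_rat => q; case: ifPn => // /set_mem /= q0.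
apply: measurableI; first exact: measurable_setI_lt.
by apply: measurable_setI_lt => //; exact: mu.
Qed.

End MeasurableFun.

(** [contract] makes real-valued processes out of caps that may be infinite, while optional sets are
    generated by real processes. *)
Lemma measurable_contract (R : realType) : measurable_fun setT (@contract R).
Proof.
apply: measurable_fun_gt => // b; rewrite setTI.
have [b1|b1] := ltP `|b| 1.
  rewrite (_ : [set x | _] = [set` `]expand b, +oo[]).
    exact: emeasurable_itv.
  apply/funext => x /=; rewrite in_itv/= andbT -[in LHS](@expandK R b) ?lt_contract//.
  by rewrite inE ltW.
have [b0|b0] := leP 0 b.
  rewrite (_ : [set x | _] = set0)//; apply/seteqP; split => x //=.
  have := contract_le1 x; rewrite ger0_norm// in b1; rewrite ler_norml => /andP[_ h].
  by rewrite ltNge (le_trans h b1).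
rewrite ltr0_norm// in b1; move: b1; rewrite le_eqVlt => /predU1P[b1|b1].
  rewrite (_ : [set x | _] = [set` `]-oo%E, +oo[]); first exact: emeasurable_itv.
  have bE : b = @contract R -oo%E by rewrite /= b1 opprK.
  by apply/funext => x /=; rewrite in_itv/= andbT [in LHS]bE lt_contract.
rewrite (_ : [set x | _] = setT)//; apply/seteqP; split => x //= _.
have := contract_le1 x; rewrite ler_norml => /andP[h _].
by apply: lt_le_trans h; rewrite ltrNr.
Qed.

Lemma contract_cvg (R : realType) (U : Type) (F : set_system U) (g : U -> \bar R) l
  {FF : Filter F} : g x @[x --> F] --> l -> contract (g x) @[x --> F] --> contract l.
Proof.
move=> gl; apply/cvgrPdist_lt => e e0.
by have := gl _ (nbhsx_ballx l e e0).
Qed.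

Section Optional.
Context {R : realType} (T : R) {disp : measure_display} {Omega : measurableType disp}.
Variable F : R -> set (set Omega).

(** Optional sets form a sigma-algebra on the horizon only. Passing to all sets with optional trace
    gives one on the whole space, hence a measurable type for which optionality is measurability on
    the horizon. *)
Definition optional_ext : set (set (R * Omega)) :=
  [set A | optional_sets T F (horizon T `&` A)].

Lemma optional_ext_sigma_algebra : sigma_algebra setT optional_ext.
Proof.
have [G0 GC GU] : sigma_algebra (horizon T) (optional_sets T F).
  exact: smallest_sigma_algebra.
split; rewrite /optional_ext/=.
- by rewrite setI0.
- move=> A /GC; congr (optional_sets _ _ _).
  by rewrite setDIr setDv set0U setTD setDE.
- by move=> A hA; rewrite setI_bigcupr; apply: GU.
Qed.

Definition optionalType := g_sigma_algebraType optional_ext.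

HB.instance Definition _ := Measurable.on optionalType.

Lemma measurable_optionalE (A : set optionalType) :
  measurable A = optional_sets T F (horizon T `&` A).
Proof.
by rewrite [measurable](measurable_g_measurableTypeE optional_ext_sigma_algebra).
Qed.

Lemma measurable_optional_horizon : measurable (horizon T : set optionalType).
Proof.
rewrite measurable_optionalE setIid.
have [G0 GC GU] : sigma_algebra (horizon T) (optional_sets T F).
  exact: smallest_sigma_algebra.
by rewrite -[horizon T]setD0; apply: GC.
Qed.

Lemma optionalP (c : R * Omega -> R) :
  optional T F c <-> measurable_fun (horizon T : set optionalType) (c : optionalType -> R).
Proof.
split=> [oc _ B mB|mc _ [B mB <-]].
  by rewrite measurable_optionalE setIA setIid; apply: oc; exists B.
have := mc measurable_optional_horizon _ mB.
by rewrite measurable_optionalE setIA setIid.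
Qed.

Lemma adapted_cadlag_optional (X : R * Omega -> R) :
  adapted T F X -> cadlag T X -> optional T F X.
Proof.
by move=> aX cX A [B mB <-]; apply: sub_sigma_algebra; exists X => //; exists B.
Qed.

Hypothesis F_sigma : forall t : R, t \in `[0, T] -> sigma_algebra setT (F t).

(** For a deterministic process all events are empty or everything, so it is adapted; continuity
    makes it cadlag. *)
Lemma Lipschitz_optional (f : R -> R) (C : R) :
  (forall t s, t \in `[0, T] -> s \in `[0, T] -> `|f t - f s| <= C * `|t - s|) ->
  optional T F (fun z => f z.1).
Proof.
move=> fL; apply: adapted_cadlag_optional.
  move=> t tT B mB /=; have [F0 FC _] := F_sigma tT.
  have [Bf|Bf] := pselect (B (f t)).
    rewrite (_ : [set _ | _] = setT); last by apply/seteqP; split.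
    by rewrite -[setT]setD0; apply: FC.
  by rewrite (_ : [set _ | _] = set0)//; apply/seteqP; split.
(* [C] may be zero or negative, so one divides by [|C| + 1]. *)
have fc t (s : R) eps : t \in `[0, T] -> s \in `[0, T] ->
    `|t - s| < eps / (`|C| + 1) -> 0 < eps -> `|f t - f s| <= eps.
  move=> tT sT ts e0; apply: le_trans (fL _ _ tT sT) _.
  have C0 : 0 < `|C| + 1 by rewrite ltr_wpDl.
  move: ts; rewrite ltr_pdivlMr// mulrC => /ltW; apply: le_trans.
  by rewrite ler_wpM2r// (le_trans (ler_norm _))// lerDl.
have d0 eps : 0 < eps -> 0 < eps / (`|C| + 1) by move=> e0; rewrite divr_gt0// ltr_wpDl.
move=> w; split => [t /=|t /=]; rewrite in_itv/= => /andP[t0 tT].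
  apply/cvgrPdist_le => eps eps0; near=> s.
  have ts : t < s by near: s; exact: nbhs_right_gt.
  have sT : s < T by near: s; exact: nbhs_right_lt.
  have se : s < t + eps / (`|C| + 1).
    by near: s; apply: nbhs_right_lt; rewrite ltrDl d0.
  apply: fc => //; rewrite ?in_itv/= ?t0 ?(ltW tT)// ?(ltW sT) ?andbT.
    exact: le_trans t0 (ltW ts).
  by rewrite distrC gtr0_norm ?subr_gt0// ltrBlDl.
exists (f t); apply/cvgrPdist_le => eps eps0; near=> s.
have st : s < t by near: s; exact: nbhs_left_lt.
have s0 : 0 < s by near: s; exact: nbhs_left_gt.
have se : t - eps / (`|C| + 1) < s.
  by near: s; apply: nbhs_left_gt; rewrite gtrBl d0.
apply: fc => //; rewrite ?in_itv/= ?tT ?(ltW t0)// ?(ltW s0)/=.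
  exact: le_trans (ltW st) tT.
by rewrite gtr0_norm ?subr_gt0//; lra.
Unshelve. all: by end_near. Qed.

End Optional.

Section OptionalMeasurable.
Context {R : realType} (T : R) {disp : measure_display} {Omega : measurableType disp}.
Variable F : R -> set (set Omega).
Hypothesis T0 : 0 < T.
Hypothesis F_measurable : forall t : R, t \in `[0, T] -> F t `<=` measurable.

Lemma measurable_horizon : measurable (horizon T : set (measurableTypeR R * Omega)).
Proof. by apply: measurableX. Qed.

(* [X (t, w)] is the limit of [X (grid n t, w)], as [X] is right-continuous. *)
Let grid n (t : R) : R := Num.min T ((Num.truncn (t * n.+1%:R)).+1%:R / n.+1%:R).

Let grid_gt n t : 0 <= t -> t < T -> t < grid n t.
Proof.
move=> t0 tT; rewrite lt_min tT/= ltr_pdivlMr//.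
by have /andP[_] := truncn_itv (mulr_ge0 t0 (ler0n _ n.+1)).
Qed.

Let grid_le n t : 0 <= t -> grid n t <= t + n.+1%:R^-1.
Proof.
move=> t0; rewrite ge_min; apply/orP; right.
rewrite ler_pdivrMr// mulrDl mulVf ?pnatr_eq0// -natr1 lerD2r.
by have /andP[] := truncn_itv (mulr_ge0 t0 (ler0n _ n.+1)).
Qed.

Let gridT n : grid n T = T.
Proof.
apply/min_idPl; rewrite ler_pdivlMr// ltW//.
by have /andP[] := truncn_itv (mulr_ge0 (ltW T0) (ler0n _ n.+1)).
Qed.

Let grid_cvg t : 0 <= t -> t < T -> grid n t @[n --> \oo] --> t^'+.
Proof.
move=> t0 tT A /nbhs_ballP[e /= e0 he].
have [N _ hN] := cvgr_lt (0 : R) (@cvg_harmonic R) e e0.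
exists N => // n Nn /=; apply: he; last exact: grid_gt.
rewrite -ball_normE/= distrC gtr0_norm ?subr_gt0 ?grid_gt// ltrBlDl.
by apply: le_lt_trans (grid_le n t0) _; rewrite ltrD2l; apply: hN.
Qed.

Lemma adapted_cadlag_measurable (X : R * Omega -> R) : adapted T F X -> cadlag T X ->
  measurable_fun (horizon T) (X : measurableTypeR R * Omega -> R).
Proof.
move=> aX cX.
apply: (@measurable_fun_cvg _ _ _ _ (fun n z => X (grid n z.1, z.2))) => [n|]; last first.
  move=> [t w] [/=]; rewrite in_itv/= => /andP[t0]; rewrite le_eqVlt => /predU1P[->|tT] _.
    by under eq_cvg do rewrite gridT; exact: cvg_cst.
  have [Xr _] := cX w; apply: (@cvg_comp _ _ _ (grid ^~ t) (fun s => X (s, w)) _ (t^'+)).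
    exact: grid_cvg.
  by apply: Xr; rewrite in_itv/= t0.
move=> mH B mB.
(* The grid time is constant on each cell, so the preimage is a countable union of rectangles. *)
rewrite (_ : _ `&` _ = \bigcup_k
  (([set` `[0, T]] `&` [set` `[k%:R / n.+1%:R, k.+1%:R / n.+1%:R[]) `*`
   [set w | B (X (Num.min T (k.+1%:R / n.+1%:R), w))])); last first.
  apply/seteqP; split => -[t w] /=.
    move=> [[tT _] BX]; exists (Num.truncn (t * n.+1%:R)) => //=; split => //; split => //.
    move: tT; rewrite !in_itv/= => /andP[t0 _].
    by rewrite ler_pdivrMr// ltr_pdivlMr// truncn_itv// mulr_ge0.
  move=> [k _ /= [[tT tk] BX]]; split => //.
  suff -> : grid n t = Num.min T (k.+1%:R / n.+1%:R) by [].
  congr (Num.min T (_.+1%:R / _)); apply/eqP; rewrite truncn_eq; last first.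
    by move: tT; rewrite in_itv/= => /andP[t0 _]; rewrite mulr_ge0.
  by move: tk; rewrite in_itv/= ler_pdivrMr// ltr_pdivlMr.
apply: bigcupT_measurable => k; apply: measurableX; first exact: measurableI.
have kT : Num.min T (k.+1%:R / n.+1%:R) \in `[0, T].
  by rewrite in_itv/= le_min (ltW T0) ge_min lexx divr_ge0.
by apply: (F_measurable kT); apply: aX.
Qed.

Lemma optional_sets_measurable : optional_sets T F `<=`
  (measurable : set (set (measurableTypeR R * Omega))).
Proof.
apply: smallest_sub.
  split=> [|A mA|A mA]; first exact: measurable0.
    exact: measurableD measurable_horizon mA.
  exact: bigcupT_measurable.
by move=> A [X [aX cX] [B mB <-]]; apply: adapted_cadlag_measurable measurable_horizon _ _.
Qed.

Lemma optional_measurable (c : R * Omega -> R) : optional T F c ->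
  measurable_fun (horizon T) (c : measurableTypeR R * Omega -> R).
Proof.
by move=> oc _ B mB; apply: optional_sets_measurable; apply: oc; exists B.
Qed.

(** The real process [contract] of [Gamma] is adapted and cadlag, hence optional; as [contract] is
    strictly increasing, measurability passes back to [Gamma]. *)
Lemma capped_optional (Gamma : R * Omega -> \bar R) (M : R) : 0 < M ->
  adapted T F Gamma -> cadlag T Gamma ->
  optional T F (fun z => fine (mine (Gamma z) M%:E)).
Proof.
move=> M0 aG cG; apply/optionalP.
have mc : measurable_fun (horizon T : set (optionalType T F))
    ((@contract R \o Gamma) : optionalType T F -> R).
  apply/optionalP; apply: adapted_cadlag_optional.
    move=> t tT B mB.
    have mcB : measurable (@contract R @^-1` B).
      by rewrite -[X in measurable X]setTI; apply: measurable_contract.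
    exact: (aG t tT _ mcB).
  move=> w; have [Gr Gl] := cG w; split=> t tT.
    exact: (contract_cvg (Gr t tT)).
  by have [l tl] := Gl t tT; exists (contract l); exact: (contract_cvg tl).
have mG : measurable_fun (horizon T : set (optionalType T F))
    (Gamma : optionalType T F -> \bar R).
  apply: emeasurable_fun_gt; first exact: measurable_optional_horizon.
  move=> b; rewrite (_ : [set x | _] = [set x | contract b%:E < contract (Gamma x)]).
    by apply: measurable_setI_lt => //; exact: measurable_optional_horizon.
  by apply/funext => z; rewrite /mkset lt_contract.
apply: (@measurableT_comp _ _ _ _ _ _ (@fine R)); first exact: fine_measurable.
by apply: measurable_mine.
Qed.

End OptionalMeasurable.

(** * Integration on the horizon *)

Section KappaFinite.
Context {R : realType} (T : R).

Lemma kappa_fin_num_fun : fin_num_fun (@kappa R T).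
Proof.
move=> A mA; rewrite ge0_fin_numE ?measure_ge0// /kappa measure_addE.
apply: lte_add_pinfty; last by rewrite /= diracE ltry.
rewrite /mrestr (@le_lt_trans _ _ (lebesgue_measure [set` `[0%R, T[]))//.
  by apply: le_measure; rewrite ?inE//; apply: measurableI.
by rewrite lebesgue_measure_itv/=; case: ifP => // _; rewrite -EFinB ltry.
Qed.

HB.instance Definition _ := Measure_isFinite.Build _ _ _ (@kappa R T) kappa_fin_num_fun.

Lemma kappa_setC_horizon : 0 <= T -> kappa T (~` [set` `[0, T]]) = 0%E.
Proof.
move=> T0; rewrite /kappa measure_addE /= /mrestr.
rewrite (_ : _ `&` _ = set0) ?measure0 ?add0e.
  by rewrite diracE memNset//= => /(_ _); apply; rewrite in_itv/= T0 lexx.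
apply/seteqP; split => x //= [] xT; rewrite in_itv/= => /andP[x0 /ltW xT'].
by apply: xT; rewrite in_itv/= x0.
Qed.

Lemma kappa_ge_terminal (A : set R) : measurable (A : set (measurableTypeR R)) ->
  A T -> (1 <= kappa T A)%E.
Proof.
move=> mA AT; rewrite /kappa measure_addE /= diracE mem_set// leeDr// /mrestr measure_ge0.
Qed.

End KappaFinite.

Section IteratedIntegral.
Context {d1 d2 : measure_display} {T1 : measurableType d1} {T2 : measurableType d2}.
Context {R : realType} (m1 : {sigma_finite_measure set T1 -> \bar R}).
Context (m2 : {sigma_finite_measure set T2 -> \bar R}).
Variables (D : set T1) (f : T1 * T2 -> \bar R).
Hypothesis mD : measurable D.
Let H : set (T1 * T2) := D `*` setT.
Let mH : measurable H. Proof. exact: measurableX. Qed.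

Let patchE (g : T1 * T2 -> \bar R) y : (fun x => (g \_ H) (x, y)) = (fun x => g (x, y)) \_ D.
Proof.
apply/funext => x; rewrite /patch; case: ifPn => [/set_mem[/= Dx _]|Dx].
  by rewrite mem_set.
by case: ifPn => // /set_mem /= Dx'; case/negP: Dx; apply/mem_set.
Qed.

Lemma iterated_integral_ge0 :
  measurable_fun H f -> (forall z, H z -> (0 <= f z)%E) ->
  (\int[m2]_y \int[m1]_(x in D) f (x, y) = \int[m1 \x m2]_(z in H) f z)%E.
Proof.
move=> mf f0; rewrite [RHS]integral_mkcond fubini_tonelli2.
- by apply: eq_integral => y _; rewrite /fubini_G patchE -integral_mkcond.
- exact/(measurable_restrictT f mH).
- by move=> z; rewrite /patch; case: ifPn => // /set_mem /f0.
Qed.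

Lemma iterated_integral : (m1 \x m2)%E.-integrable H f ->
  (\int[m2]_y \int[m1]_(x in D) f (x, y) = \int[m1 \x m2]_(z in H) f z)%E.
Proof.
move=> imf; rewrite [RHS]integral_mkcond -integral21_prod_meas1.
  by apply: eq_integral => y _; rewrite /fubini_G patchE -integral_mkcond.
exact/(integrable_mkcond f mH).
Qed.

End IteratedIntegral.

Lemma iterated_integral_mine0 {d1 d2 : measure_display} {T1 : measurableType d1}
    {T2 : measurableType d2} {R : realType} (m1 : {sigma_finite_measure set T1 -> \bar R})
    (m2 : {sigma_finite_measure set T2 -> \bar R}) (D : set T1) (f : T1 * T2 -> \bar R) :
  measurable D -> measurable_fun (D `*` setT) f ->
  (\int[m2]_y \int[m1]_(x in D) mine 0 (f (x, y)) =
   - \int[m1 \x m2]_(z in D `*` setT) f^\- z)%E.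
Proof.
move=> mD mf; rewrite -iterated_integral_ge0//; last exact: measurable_funeneg.
have mine0E z : mine 0%E (f z) = (- (f^\- z))%E.
  by rewrite funenegE oppe_max oppeK oppe0 minC.
rewrite -integral_ge0N => [|y _]; last exact: integral_ge0.
apply: eq_integral => y _; rewrite -integral_ge0N//.
by apply: eq_integral => x _; rewrite mine0E.
Qed.

Section ProductMeasure.
Context {R : realType} (T : R) {disp : measure_display} {Omega : measurableType disp}.
Variable P : probability Omega R.
Hypothesis T0 : 0 < T.

Local Notation mu := (kappa T \x P)%E.
Local Notation H := (horizon T : set (measurableTypeR R * Omega)).

Let mH : measurable H := measurable_horizon T.
Let mT : measurable ([set` `[0, T]] : set (measurableTypeR R)) := measurable_itv _.

Lemma ae_filter : Filter (nbhs (almost_everywhere mu)). Proof. exact _. Qed.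

Lemma mu_horizon_lty : (mu H < +oo)%E.
Proof.
have -> : mu H = (kappa T [set` `[0%R, T]] * P setT)%E by apply: product_measure1E.
rewrite probability_setT mule1 -ge0_fin_numE ?measure_ge0//.
exact: kappa_fin_num_fun.
Qed.

Lemma ae_horizon (Q : measurableTypeR R * Omega -> Prop) :
  (forall z, H z -> Q z) -> {ae mu, forall z, Q z}.
Proof.
move=> hQ; have mTC : measurable (~` [set` `[0, T]] : set (measurableTypeR R)).
  exact: measurableC.
exists (~` [set` `[0, T]] `*` setT); split.
- exact: measurableX.
- have -> : mu (~` [set` `[0, T]] `*` setT) = (kappa T (~` [set` `[0%R, T]]) * P setT)%E.
    exact: product_measure1E.
  by rewrite kappa_setC_horizon ?mul0e ?(ltW T0).
- move=> [t w] /= nQ; split => // tT; apply: nQ; apply: hQ; split => //.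
Qed.

Lemma ae_processT (A : measurableTypeR R * Omega -> Prop) :
  (forall z, H z -> A z) -> ae_process T P A.
Proof. by move=> hA; apply: ae_horizon => z Hz _; apply: hA. Qed.

Lemma ae_processS (A B : measurableTypeR R * Omega -> Prop) : (forall z, H z -> A z -> B z) ->
  ae_process T P A -> ae_process T P B.
Proof. by move=> AB; apply: (@filterS _ _ ae_filter) => z Az Hz; apply: AB => //; apply: Az. Qed.

Lemma ae_processS2 (A B C : measurableTypeR R * Omega -> Prop) :
  (forall z, H z -> A z -> B z -> C z) ->
  ae_process T P A -> ae_process T P B -> ae_process T P C.
Proof.
by move=> ABC; apply: (@filterS2 _ _ ae_filter) => z Az Bz Hz; apply: ABC; [|exact: Az|exact: Bz].
Qed.

Lemma ae_process_forall (d : nat) (A : 'I_d -> measurableTypeR R * Omega -> Prop) :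
  (forall i, ae_process T P (A i)) -> ae_process T P (fun z => forall i, A i z).
Proof.
move=> hA; have : {ae mu, forall z, forall i, H z -> A i z}.
  by apply: (@filter_forall _ _ _ _ ae_filter) => i; exact: hA.
by apply: (@filterS _ _ ae_filter) => z Az Hz i; apply: Az.
Qed.

Lemma ae_process_ae (A : measurableTypeR R * Omega -> Prop) :
  ae_process T P A -> {ae mu, forall z, A z}.
Proof.
have HH : {ae mu, forall z, H z} by apply: ae_horizon.
by move: HH; apply: (@filterS2 _ _ ae_filter) => z Hz; apply.
Qed.

Lemma ae_bounded_integrable (f : measurableTypeR R * Omega -> \bar R) (M : R) :
  measurable_fun H f -> ae_process T P (fun z => (`|f z| <= M%:E)%E) ->
  mu.-integrable H f.
Proof.
move=> mf fM; have M0 : 0 <= `|M| by [].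
apply/integrableP; split => //.
apply: (@le_lt_trans _ _ (\int[mu]_(z in H) (cst `|M|%:E z))%E); last first.
  rewrite integral_cst//; rewrite lte_mul_pinfty ?lee_fin//; exact: mu_horizon_lty.
apply: ae_ge0_le_integral => //.
- by apply: measurableT_comp.
- by apply: ae_processS fM => z Hz h; apply: le_trans h _; rewrite lee_fin ler_norm.
Qed.

Section UtilityFunctional.
Variables (U : R -> R -> R) (c : R * Omega -> R).
Let f z := utility_ext (U z.1) (c z).
Hypothesis mf : measurable_fun H f.

Lemma utility_functionalE : mu.-integrable H f ->
  utility_functional T P U c = (\int[mu]_(z in H) f z)%E.
Proof.
move=> imf; rewrite /utility_functional (iterated_integral_mine0 (kappa T) P mT mf).
rewrite (iterated_integral mT imf).
by rewrite ltNye eqe_oppLR /= lt_eqF// integral_funeneg_lt_pinfty.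
Qed.

(** A value other than [-oo] means that the test on the negative part is passed; the positive part
    is bounded, on a set of finite measure. *)
Lemma utility_functional_integrable (M : R) : ae_process T P (fun z => (f z <= M%:E)%E) ->
  utility_functional T P U c != -oo%E -> mu.-integrable H f.
Proof.
move=> fM; rewrite /utility_functional (iterated_integral_mine0 (kappa T) P mT mf).
case: ifPn => // fneg _; apply/integrableP; split; first exact: mf.
have -> : (\int[mu]_(z in H) `|f z| = \int[mu]_(z in H) (f^\+ z + f^\- z))%E.
  by apply: eq_integral => z _; rewrite -[LHS]/((abse \o f) z) fune_abse.
rewrite ge0_integralD//; [|exact: measurable_funepos|exact: measurable_funeneg].
apply: lte_add_pinfty; last by rewrite -lteN2 (_ : - +oo = -oo)%E.
apply: (@le_lt_trans _ _ (\int[mu]_(z in H) (cst `|M|%:E z))%E); last first.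
  rewrite integral_cst//; rewrite lte_mul_pinfty ?lee_fin//; exact: mu_horizon_lty.
apply: ae_ge0_le_integral => //.
- exact: measurable_funepos.
- by move=> z _; rewrite lee_fin.
- apply: ae_processS fM => z Hz h; rewrite funeposE ge_max lee_fin normr_ge0 andbT.
  by apply: le_trans h _; rewrite lee_fin ler_norm.
Qed.

End UtilityFunctional.

End ProductMeasure.

(** * Equilibrium *)

(** The minimum of [f] and [g] equals [f] almost everywhere and is below [g] everywhere. *)
Lemma ae_le_integral d (S : measurableType d) (R : realType) (m : {measure set S -> \bar R})
    (D : set S) (f g : S -> \bar R) : measurable D ->
  m.-integrable D f -> m.-integrable D g -> {ae m, forall x, D x -> (f x <= g x)%E} ->
  (\int[m]_(x in D) f x <= \int[m]_(x in D) g x)%E.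
Proof.
move=> mD fi gi fg.
have mf := measurable_int _ fi; have mg := measurable_int _ gi.
pose h x := mine (f x) (g x).
have mh : measurable_fun D h by apply: measurable_mine.
have fh : ae_eq m D f h by apply: filterS fg => x fg Dx; rewrite /h (min_idPl (fg Dx)).
rewrite (ae_eq_integral _ _ mD mf mh fh); apply: le_integral => //; last first.
  by move=> x _; rewrite /h ge_min lexx orbT.
apply/integrableP; split => //.
rewrite -(@ae_eq_integral _ _ _ m D (abse \o h) (abse \o f))//.
- by case/integrableP : fi.
- exact: measurableT_comp.
- exact: measurableT_comp.
- by apply: filterS fh => x fh Dx /=; rewrite fh.
Qed.

(** * Finitely additive probabilities given by a bounded density *)

Section DensityPrice.
Context {R : realType} (T : R) {disp : measure_display} {Omega : measurableType disp}.
Variables (P : probability Omega R) (F : R -> set (set Omega)).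
Hypotheses (T0 : 0 < T) (hF : standing_filtration T P F).

Local Notation mu := (kappa T \x P)%E.
Local Notation H := (horizon T : set (measurableTypeR R * Omega)).

Let mH : measurable H := measurable_horizon T.

Lemma filtration_measurable (t : R) : t \in `[0, T] -> F t `<=` measurable.
Proof.
move=> tT; rewrite -(filtration_terminal hF); apply: (filtration_mono hF) => //.
  by rewrite in_itv/= lexx ltW.
by move: tT; rewrite in_itv => /andP[].
Qed.

(** [kappa] has an atom at [T], so the section at [T] of a null set is [P]-null. *)
Lemma ae_process_terminal (A : R * Omega -> Prop) :
  ae_process T P A -> {ae P, forall w, A (T, w)}.
Proof.
move=> [N [mN N0 sN]]; exists (xsection N T); split.
- exact: measurable_xsection.
- apply/eqP; rewrite eq_le measure_ge0 andbT.
  have mT : measurable ([set T] : set (measurableTypeR R)) by exact: measurable_set1.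
  have mX : measurable (xsection N T) by exact: measurable_xsection.
  have : ((kappa T \x P)%E ([set T] `*` xsection N T) <= (kappa T \x P)%E N)%E.
    apply: le_measure; rewrite ?inE//; first exact: measurableX.
    by move=> [t w] /= [->] /xsectionP.
  rewrite N0 product_measure1E//; apply: le_trans.
  by rewrite lee_pemull// kappa_ge_terminal.
- move=> w nA; apply/xsectionP; apply: sN => /= h; apply: nA; apply: h.
  by split => //=; rewrite in_itv/= lexx ltW.
Qed.

Lemma ae_probability_nontrivial : ~ {ae P, forall w, False}.
Proof.
move=> [N [mN N0 sN]].
have : (P setT <= P N)%E by apply: le_measure; rewrite ?inE// => w _; apply: sN => /=.
by rewrite N0 probability_setT lee_fin ler10.
Qed.

Lemma Rintegral_eq0_ae (f : measurableTypeR R * Omega -> R) : measurable_fun H f ->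
  mu.-integrable H (EFin \o f) ->
  (forall z, H z -> 0 <= f z) -> (\int[mu]_(z in H) f z)%R = 0 -> ae_process T P (fun z => f z = 0).
Proof.
move=> mf fi f0 If.
have : (\int[mu]_(z in H) `|(EFin \o f) z| = 0)%E.
  rewrite (eq_integral (EFin \o f)); last first.
    by move=> z /set_mem Hz; rewrite gee0_abs// lee_fin f0.
  by rewrite -[LHS]fineK ?integrable_fin_num// -[fine _]/(Rintegral _ _ _) If.
move=> /(ae_eq_integral_abs mu mH (measurable_int _ fi)) /= h.
by apply: (@filterS _ _ (ae_filter T P) _ _ _ h) => z hz Hz; have [] := hz Hz.
Qed.

Lemma Linfty_bounded (c : R * Omega -> R) (N : R) :
  optional T F c -> ae_process T P (fun z => `|c z| <= N) -> Linfty T P F c.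
Proof.
move=> oc cN; split => //; rewrite unlock; case: ifPn => // _.
apply: (@le_lt_trans _ _ N%:E); last exact: ltry.
by apply: ereal_inf_lbound; apply: ae_process_ae.
Qed.

Lemma Linfty_norm (c : R * Omega -> R) : Linfty T P F c ->
  exists2 N : R, ('N[mu]_+oo [EFin \o c])%E = N%:E & ae_process T P (fun z => `|c z| <= N).
Proof.
move=> [oc cN].
have N0 : (0 <= 'N[mu]_+oo [EFin \o c])%E by apply: Lnorm_ge0.
exists (fine ('N[mu]_+oo [EFin \o c])%E); first by rewrite fineK// ge0_fin_numE.
have h : {ae mu, forall z, ((abse \o (EFin \o c)) z <= 'N[mu]_+oo [EFin \o c])%E}.
  have -> : ('N[mu]_+oo [EFin \o c] =
      if mu setT > 0 then ess_sup mu (abse \o (EFin \o c)) else 0)%E by rewrite unlock.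
  case: ifPn => [_|]; first exact: ess_sup_ge.
  rewrite -leNgt => mu0; exists setT; split => //.
  by apply/eqP; rewrite eq_le mu0 measure_ge0.
apply: (@filterS _ _ (ae_filter T P) _ _ _ h) => z /= hz _.
by rewrite -lee_fin fineK// ge0_fin_numE.
Qed.

Lemma ae_le_Rintegral (f g : measurableTypeR R * Omega -> R) :
  mu.-integrable H (EFin \o f) -> mu.-integrable H (EFin \o g) ->
  ae_process T P (fun z => f z <= g z) ->
  \int[mu]_(z in H) f z <= \int[mu]_(z in H) g z.
Proof.
move=> fi gi fg; apply: fine_le; rewrite ?integrable_fin_num//.
by apply: ae_le_integral => //; apply: ae_processS fg => z _ /=; rewrite lee_fin.
Qed.

Lemma cst_Linfty (a : R) : Linfty T P F (cst a).
Proof.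
apply: (Linfty_bounded (N := `|a|)); last exact: ae_processT.
by apply/optionalP.
Qed.

Variables (y : R * Omega -> R) (K : R).
Hypotheses (my : measurable_fun H (y : measurableTypeR R * Omega -> R)).
Hypotheses (y_ge0 : forall z, H z -> 0 <= y z) (y_le : forall z, H z -> y z <= K).
Hypothesis y_not0 : ~ ae_process T P (fun z => y z = 0).

Lemma density_price_integrable c : Linfty T P F c ->
  mu.-integrable H (EFin \o (fun z => y z * c z)).
Proof.
move=> cL; have [N _ cN] := Linfty_norm cL.
apply: (ae_bounded_integrable (M := K * N)).
  apply/measurable_EFinP; apply: measurable_funM => //.
  by have [oc _] := cL; apply: (optional_measurable T0 filtration_measurable).
apply: ae_processS cN => z Hz cN; rewrite lee_fin normrM ler_pM//.
by rewrite ger0_norm ?y_ge0 ?y_le.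
Qed.

Definition density_mass : R := \int[mu]_(z in H) y z.

Definition density_price (c : R * Omega -> R) : R := \int[mu]_(z in H) (y z * c z) / density_mass.

Let y_integrable : mu.-integrable H (EFin \o y).
Proof.
have := density_price_integrable (cst_Linfty 1); apply: eq_integrable => // z _ /=.
by rewrite mulr1.
Qed.

Lemma density_mass_gt0 : 0 < density_mass.
Proof.
rewrite lt_def; apply/andP; split; last exact: Rintegral_ge0.
by apply/negP => /eqP y0; apply: y_not0; apply: Rintegral_eq0_ae.
Qed.

Lemma density_price_le (c c' : R * Omega -> R) : Linfty T P F c -> Linfty T P F c' ->
  ae_process T P (fun z => c z <= c' z) -> density_price c <= density_price c'.
Proof.
move=> cL c'L cc'; rewrite ler_pM2r ?invr_gt0 ?density_mass_gt0//.
apply: ae_le_Rintegral; [exact: density_price_integrable|exact: density_price_integrable|].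
by apply: ae_processS cc' => z Hz; apply: ler_wpM2l; apply: y_ge0.
Qed.

Lemma density_price_linear (a : R) c c' : Linfty T P F c -> Linfty T P F c' ->
  density_price (fun z => a * c z + c' z) = a * density_price c + density_price c'.
Proof.
move=> cL c'L; rewrite /density_price mulrA -mulrDl; congr (_ / _).
have ci := density_price_integrable cL; have c'i := density_price_integrable c'L.
rewrite -RintegralZl// -RintegralD//; last first.
  by have := integrableZl mH a ci; apply: eq_integrable.
by apply: eq_Rintegral => z _; rewrite mulrDr mulrCA.
Qed.

Lemma density_price_cst (a : R) : density_price (cst a) = a.
Proof.
rewrite /density_price; under eq_Rintegral do rewrite mulrC.
rewrite RintegralZl// mulfK// gt_eqF//; exact: density_mass_gt0.
Qed.

Lemma density_price_finadd_probability : finadd_probability T P F density_price.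
Proof.
split.
- by move=> a c c'; apply: density_price_linear.
(* The constant is 1: [c] lies a.e. between the constants [- N] and [N], which are their own
   prices. *)
- exists 1 => c cL; have [N -> cN] := Linfty_norm cL.
  rewrite mul1e lee_fin ler_norml -{1}(density_price_cst (- N)) -{2}(density_price_cst N).
  have cL' := cst_Linfty.
  apply/andP; split; apply: density_price_le => //; apply: ae_processS cN => z _;
    by rewrite ler_norml => /andP[].
- move=> c [cL c0]; rewrite -(density_price_cst 0); apply: density_price_le => //.
  exact: cst_Linfty.
- exact: density_price_cst.
Qed.

End DensityPrice.

(** * Budget gaps and the equilibrium obtained from their common zero *)

Section Economy.
Context {R : realType} (T : R) {disp : measure_display} {Omega : measurableType disp}.
Variables (P : probability Omega R) (F : R -> set (set Omega)) (d : nat).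
Variables (U I : 'I_d -> R -> R -> R) (e : 'I_d -> R * Omega -> R).
Variables (Gamma : 'I_d -> R * Omega -> \bar R) (eps : 'I_d -> R) (K : R).
Hypotheses (T0 : 0 < T) (hF : standing_filtration T P F) (d0 : (0 < d)%N).
Hypothesis hI : forall i (t : R), t \in `[0, T] -> inverse_marginal_utility (I i t).
Hypothesis I_optional : forall i (y : R), 0 < y -> optional T F (fun z => I i z.1 y).
Hypotheses (K0 : 0 < K) (eps0 : forall i, 0 < eps i).
Hypothesis I_K : forall i (t y : R), t \in `[0, T] -> K <= y -> I i t y < eps i.
Hypothesis he : forall i, optional T F (e i).
Hypothesis he_bounds : forall i, ae_process T P (fun z => eps i <= e i z <= (eps i)^-1).
Hypothesis hGamma : forall i, withdrawal_cap T P F (e i) (Gamma i).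

Local Notation mu := (kappa T \x P)%E.
Local Notation H := (horizon T : set (measurableTypeR R * Omega)).
Local Notation Hopt := (horizon T : set (optionalType T F)).

Let F_measurable (t : R) : t \in `[0, T] -> F t `<=` measurable.
Proof. exact: filtration_measurable hF t. Qed.

Let mH : measurable H := measurable_horizon T.
Let mHopt : measurable Hopt. Proof. exact: measurable_optional_horizon. Qed.

(* Modifications of [e] and [Gamma] on a null set, resp. above a level that no
   feasible allocation reaches. *)
Definition clipped_endowment i z : R := Num.max (eps i) (Num.min (e i z) (eps i)^-1).
Definition cap_level : R := 1 + \sum_i (eps i + (eps i)^-1).
Definition finite_cap i z : R := fine (mine (Gamma i z) cap_level%:E).

Local Notation e' := clipped_endowment.
Local Notation M := cap_level.
Local Notation G := finite_cap.

(** The clip is at most the larger of [eps i] and its inverse; the sum bounds both without comparing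
    [eps i] with one. *)
Lemma clipped_endowment_bounds i z : eps i <= e' i z <= eps i + (eps i)^-1.
Proof.
have ei := eps0 i; have ei' : 0 < (eps i)^-1 by rewrite invr_gt0.
rewrite /e' le_max lexx/= ge_max; apply/andP; split; first by rewrite lerDl ltW.
by rewrite ge_min; apply/orP; right; rewrite lerDr ltW.
Qed.

Lemma clipped_endowment_gt0 i z : 0 < e' i z.
Proof. by have /andP[h _] := clipped_endowment_bounds i z; apply: lt_le_trans h. Qed.

Lemma sum_clipped_endowment_lt z : \sum_i e' i z < M.
Proof.
rewrite /M ltr_pwDl//; apply: ler_sum => i _.
by have /andP[] := clipped_endowment_bounds i z.
Qed.

Lemma clipped_endowment_le i z : e' i z <= M.
Proof.
apply: le_trans (ltW (sum_clipped_endowment_lt z)); rewrite (bigD1 i)//= lerDl.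
by apply: sumr_ge0 => j _; apply/ltW/clipped_endowment_gt0.
Qed.

Lemma cap_level_gt0 : 0 < M.
Proof.
by rewrite ltr_pwDl// sumr_ge0// => i _; rewrite addr_ge0// ?invr_ge0// ltW.
Qed.

Lemma clipped_endowment_ae i : ae_process T P (fun z => e' i z = e i z).
Proof.
apply: ae_processS (he_bounds i) => z _ /andP[h1 h2].
by rewrite /e' (min_idPl h2) (max_idPr h1).
Qed.

Lemma finite_capE i z : H z -> (G i z)%:E = mine (Gamma i z) M%:E.
Proof.
move=> Hz; rewrite /G fineK//; have := cap_gt0 (hGamma i) Hz.
by case: (Gamma i z) => [g||]//= _; rewrite /mine; case: ifP.
Qed.

Lemma finite_cap_gt0 i z : H z -> 0 < G i z.
Proof.
move=> Hz; rewrite -lte_fin finite_capE// lt_min (cap_gt0 (hGamma i) Hz)/=.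
by rewrite lte_fin cap_level_gt0.
Qed.

Lemma finite_cap_le i z : H z -> G i z <= M.
Proof. by move=> Hz; rewrite -lee_fin finite_capE// ge_min lexx orbT. Qed.

Lemma finite_cap_le_Gamma i z : H z -> ((G i z)%:E <= Gamma i z)%E.
Proof. by move=> Hz; rewrite finite_capE// ge_min lexx. Qed.

Definition state_price (l : 'I_d -> R) (z : R * Omega) : R :=
  clearing_price (fun i => I i z.1) (G ^~ z) (e' ^~ z) l.

Definition weighted_demand l i z : R :=
  capped_demand (I i z.1) (G i z) (l i) (state_price l z).

Local Notation y := state_price.
Local Notation D := weighted_demand.

Section AtState.
Variable z : R * Omega.
Hypothesis Hz : H z.

Let tT : z.1 \in `[0, T]. Proof. by case: Hz. Qed.
Let hIz i : inverse_marginal_utility (I i z.1) := hI i tT.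
Let Gz0 i : 0 < G i z := finite_cap_gt0 i Hz.
Let ez0 i : 0 < e' i z := clipped_endowment_gt0 i z.
Let IKz i (x : R) : K <= x -> I i z.1 x < e' i z.
Proof.
move=> Kx; have /andP[h _] := clipped_endowment_bounds i z.
exact: lt_le_trans (I_K i tT Kx) h.
Qed.

Lemma state_price_ge0 l : simplex l -> 0 <= y l z.
Proof. exact: (clearing_price_ge0 _ d0 hIz ez0 K0 IKz). Qed.

Lemma state_price_le l : simplex l -> y l z <= K.
Proof. exact: (clearing_price_leK _ d0 hIz ez0 K0 IKz). Qed.

Lemma weighted_demand_ge0 l i : 0 <= D l i z.
Proof. exact: capped_demand_ge0. Qed.

Lemma weighted_demand_le l i : D l i z <= G i z.
Proof. exact: capped_demand_le. Qed.

Lemma sum_weighted_demand l : simplex l -> 0 < y l z -> \sum_i D l i z = \sum_i e' i z.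
Proof. exact: (aggregate_demand_clearing_price d0 hIz Gz0 ez0 K0 IKz). Qed.

Lemma state_price_gtP l a : simplex l -> 0 <= a ->
  a < y l z <-> exists q : rat, a < ratr q /\
    \sum_i e' i z <= aggregate_demand (fun i => I i z.1) (G ^~ z) l (ratr q).
Proof. exact: (clearing_price_gtP _ d0 hIz ez0 K0 IKz). Qed.

Lemma state_price_cvg (l_ : nat -> 'I_d -> R) l :
  (forall n, simplex (l_ n)) -> simplex l ->
  (forall i, l_ n i @[n --> \oo] --> l i) -> y (l_ n) z @[n --> \oo] --> y l z.
Proof. exact: (clearing_price_cvg d0 hIz Gz0 ez0 K0 IKz). Qed.

Lemma state_price_demand_cvg (l_ : nat -> 'I_d -> R) l i :
  (forall n, simplex (l_ n)) -> simplex l ->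
  (forall i, l_ n i @[n --> \oo] --> l i) ->
  y (l_ n) z * D (l_ n) i z @[n --> \oo] --> y l z * D l i z.
Proof. exact: (clearing_price_demand_cvg d0 hIz Gz0 ez0 K0 IKz). Qed.

Lemma state_price_gt0_uncapped l j : simplex l -> 0 < l j -> Gamma j z = +oo%E -> 0 < y l z.
Proof.
move=> lS lj Gy; apply: (clearing_price_gt0_cap d0 hIz Gz0 ez0 K0 IKz lS lj).
by rewrite -lee_fin finite_capE// Gy minye lee_fin ltW// sum_clipped_endowment_lt.
Qed.

Lemma state_price_gt0 l : simplex l -> (forall i, 0 < l i) ->
  (forall i, ((e' i z)%:E < Gamma i z)%E) -> 0 < y l z.
Proof.
move=> lS l0 eG; apply: (clearing_price_gt0 d0 hIz ez0 K0 IKz lS l0).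
apply: ler_sum => i _; rewrite -lee_fin finite_capE// le_min ltW//=.
by rewrite lee_fin clipped_endowment_le.
Qed.

End AtState.

Lemma finite_cap_measurable i : measurable_fun Hopt (G i).
Proof.
apply/optionalP; apply: capped_optional; first exact: cap_level_gt0.
  exact: cap_adapted (hGamma i).
exact: cap_cadlag (hGamma i).
Qed.

Lemma clipped_endowment_measurable i : measurable_fun Hopt (e' i).
Proof.
apply: measurable_maxr => //; apply: measurable_minr => //.
exact/optionalP.
Qed.

Lemma aggregate_demand_measurable l (a : R) :
  measurable_fun Hopt (fun z => aggregate_demand (fun i => I i z.1) (G ^~ z) l a).
Proof.
apply: measurable_sum => i; rewrite /capped_demand.
case E : ((0 < l i) && (0 < a)) => //; move/andP: E => [li a0].
apply: measurable_minr; first exact: finite_cap_measurable.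
by apply/optionalP; apply: I_optional; rewrite divr_gt0.
Qed.

Lemma state_price_measurable l : simplex l -> measurable_fun Hopt (y l).
Proof.
move=> lS; apply: measurable_fun_gt => // b; have [b0|b0] := ltP b 0.
  rewrite (_ : _ `&` _ = Hopt)//; apply/seteqP; split => z /= [] // Hz.
  by split => //; apply: lt_le_trans b0 _; apply: state_price_ge0.
rewrite (_ : _ `&` _ = \bigcup_(q in [set q : rat | b < ratr q])
   (Hopt `&` [set z | \sum_i e' i z <= aggregate_demand (fun i => I i z.1) (G ^~ z) l (ratr q)])).
  rewrite bigcup_mkcond; apply: bigcupT_measurable_rat => q; case: ifPn => // _.
  apply: measurable_setI_le => //; last exact: aggregate_demand_measurable.
  by apply: measurable_sum => i; apply: clipped_endowment_measurable.
apply/seteqP; split => z /=.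
  by move=> [Hz /(state_price_gtP Hz lS b0)[q [bq sq]]]; exists q.
by move=> [q /= bq [Hz sq]]; split => //; apply/(state_price_gtP Hz lS b0); exists q.
Qed.

Lemma weighted_demand_measurable l i : simplex l -> measurable_fun Hopt (D l i).
Proof.
move=> lS; have my := state_price_measurable lS.
have m0 : measurable_fun Hopt (cst 0 : optionalType T F -> R) by [].
have [l0|l0] := ltP 0 (l i); last first.
  apply: eq_measurable_fun m0 => z _; rewrite /D /capped_demand ltNge l0.
  by [].
(* The 1 is a placeholder where the price vanishes, since [measurable_fun_decr_comp] wants a
   positive argument on the whole horizon; demand is 0 there anyway. *)
pose r z := if 0 < y l z then y l z / l i else 1.
have my0 : measurable_fun Hopt (fun z => 0 < y l z) by apply: measurable_fun_ltr.
have mr : measurable_fun Hopt r.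
  by apply: measurable_fun_ifD => //; apply: measurable_funM.
have mI : measurable_fun Hopt (fun z => I i z.1 (r z)).
  apply: (@measurable_fun_decr_comp _ _ _ Hopt (fun z => I i z.1)) => //.
  - by move=> q q0; apply/optionalP; apply: I_optional.
  - by move=> z x x' [tT _]; apply: (imu_decr (hI i tT)).
  - by move=> z x [tT _]; apply: (imu_continuous (hI i tT)).
  - by move=> z _; rewrite /r; case: ifP => // y0; rewrite divr_gt0.
have : measurable_fun Hopt (fun z => if 0 < y l z then Num.min (G i z) (I i z.1 (r z)) else 0).
  apply: measurable_fun_ifD => //; apply: measurable_minr => //.
  exact: finite_cap_measurable.
apply: eq_measurable_fun => z _; rewrite /D /capped_demand l0/= /r.
by case: (0 < y l z).
Qed.

Definition budget_gap i l : R :=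
  (\int[mu]_(z in H) (y l z * (e' i z - D l i z)))%R.

Let opt_mu (c : R * Omega -> R) : measurable_fun Hopt c -> measurable_fun H c.
Proof. by move=> /optionalP; apply: optional_measurable. Qed.

Lemma gap_bound l i z : simplex l -> H z -> `|y l z * (e' i z - D l i z)| <= K * M.
Proof.
move=> lS Hz; have y0 := state_price_ge0 Hz lS.
rewrite normrM [X in X * _]ger0_norm// ler_pM ?state_price_le//.
have h1 := clipped_endowment_le i z; have h2 := clipped_endowment_gt0 i z.
have h3 := weighted_demand_ge0 Hz l i.
have h4 := le_trans (weighted_demand_le Hz l i) (finite_cap_le i Hz).
by rewrite ler_norml; apply/andP; split; lra.
Qed.

Lemma gap_measurable l i : simplex l ->
  measurable_fun H (fun z => y l z * (e' i z - D l i z)).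
Proof.
move=> lS; apply: opt_mu; apply: measurable_funM; first exact: state_price_measurable.
by apply: measurable_funB; [exact: clipped_endowment_measurable|exact: weighted_demand_measurable].
Qed.

Lemma gap_integrable l i : simplex l ->
  mu.-integrable H (EFin \o (fun z => y l z * (e' i z - D l i z))).
Proof.
move=> lS; apply: (ae_bounded_integrable (M := K * M)) => //.
  by apply/measurable_EFinP; apply: gap_measurable.
by apply: ae_processT => // z Hz; rewrite lee_fin gap_bound.
Qed.

Lemma budget_gap_cvg i (l_ : nat -> 'I_d -> R) l :
  (forall n, simplex (l_ n)) -> simplex l -> (forall j, l_ n j @[n --> \oo] --> l j) ->
  budget_gap i (l_ n) @[n --> \oo] --> budget_gap i l.
Proof.
move=> l_S lS l_l.
pose f n z : \bar R := (y (l_ n) z * (e' i z - D (l_ n) i z))%:E.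
pose g z : \bar R := (y l z * (e' i z - D l i z))%:E.
have ig : mu.-integrable H g by apply: gap_integrable.
have mf n : measurable_fun H (f n) by apply/measurable_EFinP; apply: gap_measurable.
have f_g : {ae mu, forall z, H z -> f n z @[n --> \oo] --> g z}.
  apply: (ae_processT P T0) => z Hz; apply: cvg_EFin; first by near=> n.
  (* The product is expanded because expenditure converges even where consumption does not. *)
  apply: (@cvg_trans _ ((y (l_ n) z * e' i z - y (l_ n) z * D (l_ n) i z) @[n --> \oo])).
    by apply: near_eq_cvg; near=> n; rewrite /= mulrBr.
  rewrite mulrBr; apply: cvgB; last exact: state_price_demand_cvg.
  by apply: cvgM; [exact: state_price_cvg|exact: cvg_cst].
have iK : mu.-integrable H (cst (K * M)%:E).
  by apply: (ae_bounded_integrable (M := `|K * M|)) => //; apply: ae_processT.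
have f_K : {ae mu, forall z, forall n, H z -> (`|f n z| <= cst (K * M)%:E z)%E}.
  apply: ae_process_ae => //; apply: ae_processT => // z Hz n _.
  by rewrite lee_fin gap_bound.
have [_ _ c] := dominated_convergence mH mf (measurable_int _ ig) f_g iK f_K.
by apply: fine_cvg; rewrite fineK ?integrable_fin_num.
Unshelve. all: by end_near. Qed.

(** Walras's law, state by state: either the price is zero or the market clears. *)
Lemma sum_budget_gap l : simplex l -> \sum_i budget_gap i l = 0.
Proof.
move=> lS; apply: EFin_inj; rewrite -sumEFin.
rewrite (eq_bigr (fun i => \int[mu]_(z in H) (y l z * (e' i z - D l i z))%:E)%E); last first.
  by move=> i _; rewrite /budget_gap /Rintegral fineK// integrable_fin_num//; exact: gap_integrable.
rewrite -integral_sum//; last by move=> i; exact: gap_integrable.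
rewrite (eq_integral (cst 0%E)) ?integral0// => z /set_mem Hz.
rewrite sumEFin -mulr_sumr sumrB.
have := state_price_ge0 Hz lS; rewrite le_eqVlt => /predU1P[<-|y0]; first by rewrite mul0r.
by rewrite sum_weighted_demand// subrr mulr0.
Qed.

Lemma budget_gap_weight0 i l : l i = 0 ->
  budget_gap i l = (\int[mu]_(z in H) (y l z * e' i z))%R.
Proof.
move=> li; apply: eq_Rintegral => z _.
by rewrite /D /capped_demand li ltxx/= subr0.
Qed.

Lemma budget_gap_ge0 i l : simplex l -> l i = 0 -> 0 <= budget_gap i l.
Proof.
move=> lS li; rewrite budget_gap_weight0//; apply: Rintegral_ge0 => z Hz.
by rewrite mulr_ge0 ?state_price_ge0// ltW// clipped_endowment_gt0.
Qed.

(** Some agent has positive weight and is uncapped at [T], so the price is positive there almost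
    surely, and [kappa] charges [T]. *)
Lemma state_price_not_ae0 l : simplex l -> ~ ae_process T P (fun z => y l z = 0).
Proof.
move=> lS hy.
have y0 : {ae P, forall w, y l (T, w) = 0} by exact: (ae_process_terminal T0 hy).
have [j lj] : exists j, 0 < l j.
  apply: contrapT => /forallNP nl; have [l0 l1] := lS.
  have : \sum_i l i = 0.
    by apply: big1 => i _; apply/eqP; rewrite eq_le l0 andbT leNgt; apply/negP/nl.
  by rewrite l1 => /eqP; rewrite oner_eq0.
suff : {ae P, forall w, False} by exact: ae_probability_nontrivial.
move: (cap_terminal (hGamma j)) y0; apply: filterS2 => w Gw yw.
have Hw : H (T, w) by split => //=; rewrite in_itv/= lexx ltW.
by have := state_price_gt0_uncapped Hw lS lj Gw; rewrite yw ltxx.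
Qed.

(** An agent of weight zero consumes nothing, so a zero gap makes its endowment worthless;
    endowments being positive, the price would vanish a.e. *)
Lemma budget_gap_zero : exists2 l, simplex l &
  (forall i, 0 < l i) /\ (forall i, budget_gap i l = 0).
Proof.
have [l lS l0] := simplex_zero d0 budget_gap_cvg sum_budget_gap budget_gap_ge0.
exists l => //; split => // i; rewrite lt_def; have [-> _] := lS.
rewrite andbT; apply/negP => /eqP li; apply: (state_price_not_ae0 lS).
have mye : measurable_fun H (fun z => y l z * e' i z).
  apply: opt_mu; apply: measurable_funM; first exact: state_price_measurable.
  exact: clipped_endowment_measurable.
have h : ae_process T P (fun z => y l z * e' i z = 0).
  apply: Rintegral_eq0_ae => //.
  - have := gap_integrable i lS; apply: eq_integrable => // z _ /=.
    by rewrite /D /capped_demand li ltxx/= subr0.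
  - by move=> z Hz; rewrite mulr_ge0 ?state_price_ge0// ltW// clipped_endowment_gt0.
  - by rewrite -budget_gap_weight0.
apply: ae_processS h => z _ /eqP; rewrite mulf_eq0 => /orP[/eqP//|].
by rewrite gt_eqF// clipped_endowment_gt0.
Qed.

Section Equilibrium.
Variable l : 'I_d -> R.
Hypotheses (lS : simplex l) (l0 : forall i, 0 < l i).
Hypothesis gap0 : forall i, budget_gap i l = 0.

(** All weights are positive and almost everywhere the endowments lie below the caps, so the agents
    can absorb the supply. *)
Lemma state_price_ae_gt0 : ae_process T P (fun z => 0 < y l z).
Proof.
apply: (@ae_processS2 _ _ _ _ _ (fun z => forall i, e' i z = e i z)
  (fun z => forall i, ((e i z)%:E < Gamma i z)%E)).
- move=> z Hz ee' eG; apply: state_price_gt0 => // i; by rewrite ee'.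
- by apply: ae_process_forall => i; apply: clipped_endowment_ae.
- by apply: ae_process_forall => i; apply: (cap_gt (hGamma i)).
Qed.

Let my : measurable_fun H (y l : measurableTypeR R * Omega -> R).
Proof. by apply: opt_mu; apply: state_price_measurable. Qed.
Let y_ge0 z : H z -> 0 <= y l z. Proof. by move=> Hz; apply: state_price_ge0. Qed.
Let y_le z : H z -> y l z <= K. Proof. by move=> Hz; apply: state_price_le. Qed.
Let y_not0 := state_price_not_ae0 lS.

Local Notation price := (density_price T P (y l)).

Lemma price_integrable c : Linfty T P F c ->
  mu.-integrable H (EFin \o (fun z => y l z * c z)).
Proof. exact: (density_price_integrable T0 hF my y_ge0 y_le). Qed.

Let price_le := density_price_le T0 hF my y_ge0 y_le y_not0.
Let mass_gt0 : 0 < density_mass T P (y l) := density_mass_gt0 T0 hF my y_ge0 y_le y_not0.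

Lemma weighted_demand_Linfty i : Linfty T P F (D l i).
Proof.
apply: (Linfty_bounded T0 (N := M)).
  by apply/optionalP; apply: weighted_demand_measurable.
apply: ae_processT => // z Hz; rewrite ger0_norm ?weighted_demand_ge0//.
exact: le_trans (weighted_demand_le Hz l i) (finite_cap_le i Hz).
Qed.

Lemma clipped_endowment_Linfty i : Linfty T P F (e' i).
Proof.
apply: (Linfty_bounded T0 (N := M)).
  by apply/optionalP; apply: clipped_endowment_measurable.
apply: ae_processT => // z Hz; rewrite ger0_norm ?clipped_endowment_le//.
exact/ltW/clipped_endowment_gt0.
Qed.

Lemma endowment_Linfty i : Linfty T P F (e i).
Proof.
apply: (Linfty_bounded T0 (N := M)) => //.
apply: ae_processS (clipped_endowment_ae i) => z Hz <-.
by rewrite ger0_norm ?clipped_endowment_le// ltW// clipped_endowment_gt0.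
Qed.

Lemma price_endowment i : price (e i) = price (e' i).
Proof.
have eL := endowment_Linfty i; have e'L := clipped_endowment_Linfty i.
apply/eqP; rewrite eq_le; apply/andP; split; apply: price_le => //;
  by apply: ae_processS (clipped_endowment_ae i) => z _ ->.
Qed.

Lemma price_weighted_demand i : price (D l i) = price (e i).
Proof.
rewrite price_endowment; apply/eqP; rewrite -subr_eq0 -mulrBl.
have Di := price_integrable (weighted_demand_Linfty i).
have ei := price_integrable (clipped_endowment_Linfty i).
rewrite -RintegralB//.
rewrite (_ : Rintegral _ _ _ = - budget_gap i l); first by rewrite gap0 oppr0 mul0r.
rewrite /budget_gap -mulN1r -RintegralZl//; last exact: gap_integrable.
by apply: eq_Rintegral => z _; rewrite mulrBr; lra.
Qed.

Lemma weighted_demand_admissible i : admissible T P F (Gamma i) (D l i).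
Proof.
split.
  split; first exact: weighted_demand_Linfty.
  by apply: ae_processT => // z Hz; apply: weighted_demand_ge0.
apply: ae_processT => // z Hz; apply: le_trans (finite_cap_le_Gamma i Hz).
by rewrite lee_fin weighted_demand_le.
Qed.

Lemma weighted_demand_clearing :
  ae_process T P (fun z => \sum_(i < d) D l i z = \sum_(i < d) e i z).
Proof.
apply: (@ae_processS2 _ _ _ _ _ (fun z => forall i, e' i z = e i z) _ _ _ _ state_price_ae_gt0).
  by move=> z Hz ee' y0; rewrite sum_weighted_demand//; apply: eq_bigr => i _; rewrite ee'.
by apply: ae_process_forall => i; apply: clipped_endowment_ae.
Qed.

Section Optimality.
Variable i : 'I_d.
Hypotheses (hU : regular_utility T (U i)) (hIU : inverse_marginal T (U i) (I i)).

Let U_derivable t (x : R) : t \in `[0, T] -> 0 < x -> derivable (U i t) x 1.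
Proof.
by move=> tT x0; have [h _] := utility_C1 hU tT; apply: h; rewrite /= in_itv/= x0.
Qed.

Lemma weighted_demand_gt0 z : H z -> 0 < y l z -> 0 < D l i z.
Proof.
move=> Hz y0; rewrite /D /capped_demand l0 y0/= lt_min finite_cap_gt0//=.
by case: Hz => tT _; apply: (imu_gt0 (hI i tT)); rewrite divr_gt0.
Qed.

(* First-order conditions: marginal utility is [y / l] below the cap and at
   least that at the cap, where consumption cannot be increased. *)
Lemma weighted_demand_optimal z (c : R) : H z -> 0 < y l z ->
  0 <= c -> (c%:E <= Gamma i z)%E ->
  (utility_ext (U i z.1) c <=
   (U i z.1 (D l i z) + y l z / l i * (c - D l i z))%:E)%E.
Proof.
move=> Hz y0 c0 cG; have D0 := weighted_demand_gt0 Hz y0.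
have tT : z.1 \in `[0, T] by case: Hz.
have [U'0 _ _ UI] := hIU tT.
have yl0 : 0 < y l z / l i by rewrite divr_gt0.
apply: le_trans (utility_ext_tangent (utility_increasing hU tT)
  (utility_strictly_concave hU tT) D0 (U_derivable tT D0) (U'0 _ D0) c0) _.
rewrite lee_fin lerD2l.
(* By clearing, consumption stays below the truncation level, so a cap that binds is [Gamma i]
   itself, which also bounds [c]. *)
have DM : D l i z < M.
  apply: le_lt_trans (sum_clipped_endowment_lt z).
  rewrite -(sum_weighted_demand Hz lS y0) (bigD1 i)//= lerDl.
  by apply: sumr_ge0 => j _; apply: weighted_demand_ge0.
have DE : D l i z = Num.min (G i z) (I i z.1 (y l z / l i)).
  by rewrite /D /capped_demand l0 y0.
have [GI|IG] := ltP (G i z) (I i z.1 (y l z / l i)); last first.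
  by rewrite {1}DE (min_idPr IG) UI.
have DG : D l i z = G i z by rewrite DE (min_idPl (ltW GI)).
have cD : c <= D l i z.
  move: cG DM; rewrite DG -!lee_fin -lte_fin finite_capE// /mine.
  by case: ifP => // _ _; rewrite ltxx.
apply: ler_wnM2r; first by rewrite subr_le0.
have [_ _ IU _] := hIU tT.
rewrite leNgt; apply/negP => U'y.
have := imu_decr (hI i tT) (U'0 _ D0) U'y.
by rewrite IU// ltNge DG ltW.
Qed.

Let f (c : R * Omega -> R) (z : R * Omega) := utility_ext (U i z.1) (c z).

Lemma utility_measurable c : measurable_fun H (c : measurableTypeR R * Omega -> R) ->
  measurable_fun H (f c : measurableTypeR R * Omega -> \bar R).
Proof.
move=> mc; apply: (@measurable_fun_utility_ext _ _ _ H (fun z => U i z.1)) => //.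
- move=> q q0.
  have mU : measurable_fun [set` `[0, T]] (fun t : measurableTypeR R => U i t q).
    exact: (utility_measurable hU).
  move=> _ B mB.
  rewrite (_ : _ `&` _ = ([set` `[0, T]] `&` (fun t => U i t q) @^-1` B) `*` setT).
    by apply: measurableX => //; apply: mU.
  by apply/seteqP; split => -[t w] /= [[]].
- by move=> z x x' [tT _]; apply: (utility_increasing hU).
- move=> z [tT _] x; rewrite in_itv/= andbT => x0.
  by apply: differentiable_continuous; apply/derivable1_diffP; apply: U_derivable.
Qed.

(** Consumption may come close to 0, where utility may tend to [-oo]. The lower bound therefore
    comes from the first-order inequality against the clipped endowment, which is admissible and at
    least [eps i]. *)
Lemma utility_weighted_demand_bounded :
  exists B, ae_process T P (fun z => (`|f (D l i) z| <= B%:E)%E).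
Proof.
have [B1 hB1] := utility_bounded hU cap_level_gt0.
have [B2 hB2] := utility_bounded hU (eps0 i).
have l0' : 0 <= K / l i * M by rewrite mulr_ge0 ?divr_ge0 ?ltW ?cap_level_gt0.
exists (`|B1| + `|B2| + K / l i * M).
apply: (@ae_processS2 _ _ _ _ _ (fun z => ((e' i z)%:E <= Gamma i z)%E)
  _ _ _ _ state_price_ae_gt0); last first.
  apply: (ae_processS2 _ (clipped_endowment_ae i) (cap_gt (hGamma i))).
  by move=> z _ -> /ltW.
move=> z Hz eG y0; have D0 := weighted_demand_gt0 Hz y0.
have tT : z.1 \in `[0, T] by case: Hz.
have DM := le_trans (weighted_demand_le Hz l i) (finite_cap_le i Hz).
have Uinc (x x' : R) : 0 < x -> x <= x' -> U i z.1 x <= U i z.1 x'.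
  move=> x0; rewrite le_eqVlt => /predU1P[->//|xx'].
  by rewrite ltW// (utility_increasing hU).
have e0 := clipped_endowment_gt0 i z.
have := weighted_demand_optimal Hz y0 (ltW e0) eG.
rewrite /f /utility_ext D0 e0 !lee_fin => UeD.
have UD := Uinc _ _ D0 DM.
have /andP[eps_e _] := clipped_endowment_bounds i z.
have Ue := Uinc _ _ (eps0 i) eps_e.
have h1 := le_trans (ler_norm _) (hB1 _ tT).
have h2 : - `|B2| <= U i z.1 (eps i).
  by have := hB2 _ tT; rewrite ler_norml => /andP[h _]; apply: le_trans h; rewrite lerN2 ler_norm.
have h3 : y l z / l i * (e' i z - D l i z) <= K / l i * M.
  apply: (@le_trans _ _ (y l z / l i * M)).
    apply: ler_wpM2l; first by rewrite divr_ge0// ltW.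
    by have := clipped_endowment_le i z; lra.
  apply: ler_wpM2r; first exact/ltW/cap_level_gt0.
  by rewrite ler_pM2r ?invr_gt0// state_price_le.
rewrite /= ler_norml; apply/andP; split; last first.
  have := ler_norm B1; have := normr_ge0 B2; lra.
by have := normr_ge0 B1; lra.
Qed.

(** Integrate the first-order inequality: its linear term is, up to the positive factors [1 / l i]
    and the mass of [y], the price of [c] minus that of the endowment, which the budget makes
    nonpositive. *)
Lemma weighted_demand_maximizes c : budget_set T P F (e i) (Gamma i) price c ->
  (utility_functional T P (U i) c <= utility_functional T P (U i) (D l i))%E.
Proof.
move=> [[[cL c0] cG] cQ].
have [->|cN] := eqVneq (utility_functional T P (U i) c) -oo%E; first exact: leNye.
have mD : measurable_fun H (D l i) by apply: opt_mu; apply: weighted_demand_measurable.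
have mfD := utility_measurable mD.
have [B hB] := utility_weighted_demand_bounded.
have fDi := ae_bounded_integrable mfD hB.
have mc : measurable_fun H c by have [oc _] := cL; apply: (optional_measurable T0 F_measurable).
have mfc := utility_measurable mc.
have DL := weighted_demand_Linfty i.
have foc : ae_process T P (fun z =>
    (f c z <= f (D l i) z + (y l z / l i * (c z - D l i z))%:E)%E).
  apply: (ae_processS2 _ (ae_processS2 (fun z _ h1 h2 => conj h1 h2) c0 cG) state_price_ae_gt0).
  move=> z Hz [cz0 czG] y0; rewrite /f {2}/utility_ext weighted_demand_gt0//.
  by rewrite -EFinD; apply: weighted_demand_optimal.
have [N _ cNb] := Linfty_norm cL.
have fcB : ae_process T P (fun z => (f c z <= (B + K / l i * N)%:E)%E).
  have l0' : 0 < (l i)^-1 by rewrite invr_gt0.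
  apply: (ae_processS2 _ (ae_processS2 (fun z _ h1 h2 => conj h1 h2) foc hB) cNb).
  move=> z Hz [h1 h2] h3; apply: (le_trans h1); rewrite EFinD; apply: leeD.
    exact: le_trans (lee_abs _) h2.
  have D0 := weighted_demand_ge0 Hz l i.
  rewrite lee_fin; apply: (@le_trans _ _ (y l z / l i * N)).
    apply: ler_wpM2l; first by rewrite mulr_ge0 ?state_price_ge0 ?ltW.
    by have := ler_norm (c z); lra.
  apply: ler_wpM2r; first exact: le_trans (normr_ge0 _) h3.
  by rewrite ler_pM2r// state_price_le.
have fci := utility_functional_integrable mfc fcB cN.
rewrite (utility_functionalE mfc fci) (utility_functionalE mfD fDi).
pose g z := y l z / l i * (c z - D l i z).
have gE : (fun z => (l i)^-1 * (y l z * c z - y l z * D l i z)) = g.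
  by apply/funext => z; rewrite /g; ring.
have yci := price_integrable cL; have yDi := price_integrable DL.
have gi : mu.-integrable H (EFin \o g).
  rewrite -gE; have := integrableZl mH (l i)^-1 (integrableB mH yci yDi).
  by apply: eq_integrable.
have Ig : (\int[mu]_(z in H) (g z)%:E <= 0)%E.
  rewrite -[leLHS]fineK ?integrable_fin_num// lee_fin -[fine _]/(Rintegral mu H g) -gE.
  rewrite RintegralZl//; last by have := integrableB mH yci yDi; apply: eq_integrable.
  rewrite pmulr_rle0 ?invr_gt0// RintegralB// subr_le0.
  rewrite -(@ler_pM2r _ (density_mass T P (y l))^-1) ?invr_gt0 ?mass_gt0//.
  by rewrite -/(price c) -/(price (D l i)) price_weighted_demand.
apply: (@le_trans _ _ (\int[mu]_(z in H) (f (D l i) z + (g z)%:E))%E).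
  by apply: ae_le_integral => //; apply: integrableD.
by rewrite integralD// geeDl.
Qed.

End Optimality.
End Equilibrium.

Lemma equilibrium_exists :
  (forall i, regular_utility T (U i)) -> (forall i, inverse_marginal T (U i) (I i)) ->
  exists (Q : (R * Omega -> R) -> R) (c : 'I_d -> R * Omega -> R),
    abstract_equilibrium T P F U e Gamma Q c.
Proof.
move=> hU hIU; have [l lS [l0 gap0]] := budget_gap_zero.
exists (density_price T P (y l)), (D l); split.
- apply: (density_price_finadd_probability T0 hF _ _ _ (state_price_not_ae0 lS)).
  - by apply: opt_mu; apply: state_price_measurable.
  - by move=> z Hz; apply: state_price_ge0.
  - by move=> z Hz; apply: state_price_le.
- by move=> i; apply: weighted_demand_admissible.
- exact: weighted_demand_clearing.
- move=> i; split; last by move=> c; apply: weighted_demand_maximizes.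
  split; first exact: weighted_demand_admissible.
  by rewrite price_weighted_demand.
Qed.

End Economy.

Theorem theorem3p7 (R : realType) (T : R) (hT : 0 < T)
    (disp : measure_display) (Omega : measurableType disp)
    (P : probability Omega R) (F : R -> set (set Omega))
    (hF : standing_filtration T P F) (d : nat)
    (e : 'I_d -> R * Omega -> R) (U : 'I_d -> R -> R -> R)
    (Gamma : 'I_d -> R * Omega -> \bar R)
    (he : forall i, optional T F (e i))
    (he_bounds : forall i, exists2 eps : R, 0 < eps &
       ae_process T P (fun z => eps <= e i z <= eps^-1))
    (hU : forall i, regular_utility T (U i))
    (hGamma : forall i, withdrawal_cap T P F (e i) (Gamma i)) :
  exists (Q : (R * Omega -> R) -> R) (c : 'I_d -> R * Omega -> R),
    abstract_equilibrium T P F U e Gamma Q c.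
Proof.
have [d0|d0] := posnP d.
  (* Without agents the simplex of weights is empty, so the constant density serves as price;
     clearing equates two empty sums. *)
  subst d; exists (density_price T P (cst 1)), (fun _ => cst 0); split; try by case.
    apply: (density_price_finadd_probability (K := 1) hT hF) => // h.
    apply: (@ae_probability_nontrivial _ _ _ P).
    move: (ae_process_terminal hT h) => [N [mN N0 sN]]; exists N; split => // w _.
    by apply: sN => /= /eqP; rewrite oner_eq0.
  by apply: ae_processT => // z _; rewrite !big_ord0.
have [I hI] := choice (fun i => utility_inverse_marginal (hU i)).
have eps_ex i : exists eps : R, 0 < eps /\ ae_process T P (fun z => eps <= e i z <= eps^-1).
  by have [eps eps0 h] := he_bounds i; exists eps.
have [eps epsP] := choice eps_ex.
have K_ex i : exists K : R, 0 < K /\ forall t y, t \in `[0, T] -> K <= y -> I i t y < eps i.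
  have [_ _ Ioo _] := hI i; have [eps0 _] := epsP i.
  by have [K K0 hK] := inverse_marginal_pinfty Ioo eps0; exists K.
have [K KP] := choice K_ex.
(* The thresholds are positive, so their sum is beyond each of them and serves all agents at
   once. *)
apply: (@equilibrium_exists _ _ _ _ P F d U I e Gamma eps (\sum_i K i)) => //.
- move=> i t tT; have [h1 h2 h3 h4] := hI i.
  exact: regular_inverse_marginal_utility h1 h2 h4 h3 _ tT.
- move=> i y y0; have [_ h2 _ _] := hI i; have [C hC] := inverse_marginal_Lipschitz h2 y0.
  by apply: (Lipschitz_optional _ hC); apply: filtration_sigma hF.
- rewrite (bigD1 (Ordinal d0))//= ltr_pwDl//; first by case: (KP (Ordinal d0)).
  by apply: sumr_ge0 => i _; apply: ltW; case: (KP i).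
- by move=> i; case: (epsP i).
- move=> i t y tT Ky; have [_ h] := KP i; apply: h => //; apply: le_trans Ky.
  rewrite (bigD1 i)//= lerDl; apply: sumr_ge0 => j _; apply: ltW; by case: (KP j).
- by move=> i; case: (epsP i).
- by move=> i; case: (hI i).
Qed.
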